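(* Consider the smooth stochastic $N$-player game and the RSG scheme described in the context. Suppose that the stepsizes $\{\gamma_k\}_{k\ge 0}$ in the RSG scheme are chosen such that $0<\gamma_k\le 1/L$ with $\gamma_k<1/L$ for at least one $k$, and the probability mass function $P_R$ is chosen such that for any $k=1,\dots,T$, $$P_R(k)=\mathrm{Prob}\{R=k\}=\frac{\gamma_k-L\gamma_k^2}{\sum_{j=1}^T(\gamma_j-L\gamma_j^2)}.$$ Suppose that Assumption A (see context) holds. Let $D=\left[(P_{\max}-P_{\min})/L\right]^{1/2}$. Then: (i) For any $T\ge 1$, $$\mathbb{E}\left[\|\tilde G_{\gamma_R}(x^R,\xi^R)\|^2\right]\le \frac{LD^2+(\sigma^2N)\sum_{k=1}^T(\gamma_k/S_k)}{\sum_{k=1}^T(\gamma_k-L\gamma_k^2)},$$ where the expectation is taken with respect to $R$ and the history $\xi^{[k]}=(\xi^0,\dots,\xi^k)$. (ii) Suppose that we choose the stepsizes $\gamma_k=1/(2L)$ and $P_R(k)=1/T$ for all $k=1,\dots,T$. Let a sufficiently large but fixed total number $M$ of calls to the stochastic first-order oracle be given. If the number of samples $S_k$ at iteration $k$ of the RSG scheme is fixed as $$S_k=S=\left\lceil \frac{\sigma\sqrt{6M}}{4LD}\right\rceil,$$ then $T\le\lfloor M/(SN)\rfloor$ and $$\mathbb{E}\left[\|G_{\gamma_R}(x^R)\|^2\right]\le \frac{16L^2D^2N}{M}+\frac{8\sqrt6\,LDN\sigma}{\sqrt M}.$$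
   Context: Game. There are $N$ players, $[N]=\{1,\dots,N\}$. Each $X_i\subseteq\mathbb{R}^{n_i}$ is closed and convex, $X=\prod_{i=1}^N X_i\subseteq\mathbb{R}^n$, $n=\sum_i n_i$; $x=(x_i)_{i=1}^N$ and $x_{-i}=(x_j)_{j\ne i}\in X_{-i}=\prod_{j\ne i}X_j$. Given $x_{-i}$, player $i$ solves $\min_{x_i\in X_i} f_i(x_i,x_{-i})=\mathbb{E}[\tilde f_i(x_i,x_{-i},\xi)]$, where $\xi$ is a random vector and each $\tilde f_i(\cdot,x_{-i},\xi)$ is smooth (possibly nonconvex) for any $x_{-i}$ and $\xi$. A function $P:X\to\mathbb{R}$ is a potential function of the game if $P(x_i^1,x_{-i})-P(x_i^2,x_{-i})=f_i(x_i^1,x_{-i})-f_i(x_i^2,x_{-i})$ for all $i\in[N]$, $x_i^1,x_i^2\in X_i$, $x_{-i}\in X_{-i}$. ''$L$-smooth'' means continuously differentiable with $L$-Lipschitz gradient. $\Pi_X$ is Euclidean projection onto $X$. Assumption A. (A1) The game admits an $L$-smooth potential function $P$ attaining its maximum $P_{\max}$ and minimum $P_{\min}$ over $X$. (A2) For any iterate $x^k$ and $i\in[N]$, $\mathbb{E}[\nabla_{x_i}\tilde f_i(x^k_i,x^k_{-i},\xi)\mid x^k]=\nabla_{x_i}f_i(x^k_i,x^k_{-i})$. (A3) For any $x^k$, $\mathbb{E}[\|\nabla_{x_i}\tilde f_i(x^k_i,x^k_{-i},\xi)-\nabla_{x_i}f_i(x^k_i,x^k_{-i})\|^2\mid x^k]\le\sigma^2$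 for some $\sigma>0$ and any $i\in[N]$. RSG scheme. Inputs: starting point $x^0\in X$, iteration limit $T$, stepsizes $\{\gamma_k\}_{k\ge0}$, batch sizes $\{S_k\}_{k\ge0}$, and a probability mass function $P_R$ supported on $\{1,\dots,T\}$. Let $R$ be a random variable with probability mass function $P_R$. For $k=0,1,\dots,R-1$ and each $i\in[N]$: pick $S_k$ i.i.d. realizations $\{\xi^k_{i,l}\}_{l=1}^{S_k}$ of $\xi$, set $\tilde g_i(x^k,\xi_i^k)=\frac1{S_k}\sum_{l=1}^{S_k}\nabla_{x_i}\tilde f_i(x^k_i,x^k_{-i},\xi^k_{i,l})$, and update $x_i^{k+1}=\Pi_{X_i}[x_i^k-\gamma_k\tilde g_i(x^k,\xi_i^k)]$. Output $x^R$. Here $\xi^k$ denotes all samples of iteration $k$. One call to the stochastic first-order oracle returns one sampled gradient for one player, so iteration $k$ uses $NS_k$ calls. Residuals. With $F(x)=(\nabla_{x_i}f_i(x))_{i=1}^N$ and $\tilde F(x^k,\xi^k)=(\tilde g_i(x^k,\xi_i^k))_{i=1}^N$, $$G_{\gamma_k}(x^k)=\tfrac1{\gamma_k}(x^k-\Pi_X[x^k-\gamma_kF(x^k)]),\qquad \tilde G_{\gamma_k}(x^k,\xi^k)=\tfrac1{\gamma_k}(x^k-\Pi_X[x^k-\gamma_k\tilde F(x^k,\xi^k)]).$$ *)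

(* Defs.v *)
From HB Require Import structures.
From mathcomp Require Import all_boot all_order all_algebra.
From mathcomp Require Import all_classical all_reals all_analysis.
Set Implicit Arguments.
Unset Strict Implicit.
Unset Printing Implicit Defensive.
Import Order.TTheory GRing.Theory Num.Theory.
Import numFieldNormedType.Exports.
Local Open Scope classical_set_scope.
Local Open Scope ring_scope.

(* 'rV[R]_n with its Borel sigma-algebra; convertible to 'rV[R]_n. *)
Definition Rvec (R : realType) (n : nat) := g_sigma_algebraType (@open 'rV[R]_n).

Section Euclidean.
Context {R : realType} {n : nat}.
Implicit Types (x y v : 'rV[R]_n) (A : set 'rV[R]_n) (f : 'rV[R]_n -> R).

(* The library norm on 'rV[R]_n is the sup norm, whence a separate definition. *)
Definition enorm x : R := Num.sqrt (\sum_j x 0 j ^+ 2).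

(* Total via choice; for A nonempty, closed and convex the minimizer exists and
   is unique. *)
Definition proj A x : 'rV[R]_n :=
  get [set y | A y /\ forall z, A z -> enorm (x - y) <= enorm (x - z)].

Definition gradient f x : 'rV[R]_n := \row_j 'D_(delta_mx 0 j) f x.

(* Functions on A are represented by functions on the whole space; smoothness
   is required at the points of A only. *)
Definition C1_on A f : Prop :=
  (forall x, A x -> differentiable f x) /\ {within A, continuous (gradient f)}.

Definition Lsmooth_on (L : R) A f : Prop :=
  C1_on A f /\
  forall x y, A x -> A y ->
    enorm (gradient f x - gradient f y) <= L * enorm (x - y).

End Euclidean.

Section Probability.
Context {R : realType} {d : measure_display} {Om : measurableType d}.
Variable Pr : probability Om R.

Definition mutually_independent (I : finType) (G : I -> set (set Om)) : Prop :=
  forall (J : {set I}) (E : I -> set Om),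
    (forall i, i \in J -> G i (E i)) ->
    Pr (\bigcap_(i in [set` J]) E i) = (\prod_(i in J) Pr (E i))%E.

(* Y is a version of E[Z | G]. *)
Definition is_cond_exp (G : set (set Om)) (Z Y : Om -> R) : Prop :=
  [/\ Pr.-integrable setT (EFin \o Z),
      Pr.-integrable setT (EFin \o Y),
      forall B : set R, measurable B -> G (Y @^-1` B)
    & forall A, G A ->
        (\int[Pr]_(w in A) (Z w)%:E = \int[Pr]_(w in A) (Y w)%:E)%E].

End Probability.

Section Game.
Context {R : realType} {N : nat} {n_ : 'I_N -> nat} {m : nat}.

(* A strategy profile is the concatenation of the blocks x_i : 'rV_(n_ i);
   x_i is submxrow x i. *)
Notation profile := 'rV[R]_(\sum_i n_ i).

Variable X_ : forall i, set 'rV[R]_(n_ i).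

Definition feasible : set profile := [set x | forall i, X_ (submxrow x i)].

(* (u, x_{-i}) *)
Definition replace (x : profile) (i : 'I_N) (u : 'rV[R]_(n_ i)) : profile :=
  \mxrow_j dfwith (fun j => submxrow x j) i u j.

Definition pgrad (f : profile -> R) (i : 'I_N) (x : profile) : 'rV[R]_(n_ i) :=
  gradient (fun u => f (replace x u)) (submxrow x i).

Definition is_potential (f : 'I_N -> profile -> R) (P : profile -> R) : Prop :=
  forall (i : 'I_N) (x : profile) (u1 u2 : 'rV[R]_(n_ i)),
    feasible x -> X_ u1 -> X_ u2 ->
    P (replace x u1) - P (replace x u2) = f i (replace x u1) - f i (replace x u2).

Section Cost.
Context {d0 : measure_display} {Om0 : measurableType d0}.
Variables (Q : probability Om0 R) (xi0 : {RV Q >-> Rvec R m}).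
Variable ft : 'I_N -> profile -> 'rV[R]_m -> R.

Definition expected_cost (i : 'I_N) (x : profile) : R :=
  fine ('E_Q[fun w => ft i x (xi0 w)])%E.

(* Besides the explicit assumptions on the strategy sets and on ft, this records
   what the expectations and gradients occurring in the model need in order to
   exist: integrability, differentiability of the expected costs, and joint
   measurability of the sampled gradients. *)
Record smooth_stochastic_game : Prop := SmoothStochasticGame {
  strat_closed : forall i, closed (@X_ i);
  strat_convex : forall i, convex_set (@X_ i);
  sample_cost_integrable : forall i x, feasible x ->
    Q.-integrable setT (EFin \o (fun w => ft i x (xi0 w)));
  sample_cost_smooth : forall i x z, feasible x ->
    C1_on (@X_ i) (fun u => ft i (replace x u) z);
  expected_cost_differentiable : forall i x, feasible x ->
    differentiable (fun u => expected_cost i (replace x u)) (submxrow x i);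
  sample_grad_measurable : forall i j,
    measurable_fun [set p : Rvec R (\sum_i n_ i) * Rvec R m | feasible p.1]
      (fun p => pgrad (fun y => ft i y p.2) i p.1 0 j) }.

Record smooth_potential (P : profile -> R) (L Pmax Pmin : R) : Prop :=
  SmoothPotential {
  potentialP : is_potential expected_cost P;
  potential_smooth : Lsmooth_on L feasible P;
  potential_max : (exists2 x, feasible x & P x = Pmax) /\
                  (forall x, feasible x -> P x <= Pmax);
  potential_min : (exists2 x, feasible x & P x = Pmin) /\
                  (forall x, feasible x -> Pmin <= P x) }.

Definition gradF (x : profile) : profile := \mxrow_i pgrad (expected_cost i) i x.

Definition batch_grad (i : 'I_N) (x : profile) (s : nat) (z : 'I_s -> 'rV[R]_m) :
    'rV[R]_(n_ i) :=
  s%:R^-1 *: \sum_(l < s) pgrad (fun y => ft i y (z l)) i x.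

Definition batch_gradF (x : profile) (s : nat) (z : 'I_N -> 'I_s -> 'rV[R]_m) :
    profile :=
  \mxrow_i batch_grad i x (z i).

(* g^-1 (x - Pi_X[x - g v]) *)
Definition residual (g : R) (x v : profile) : profile :=
  g^-1 *: (x - proj feasible (x - g *: v)).

Section Scheme.
Context {d : measure_display} {Om : measurableType d}.
Variables (Pr : probability Om R).
Variables (x0 : profile) (gamma : nat -> R) (S : nat -> nat).
(* xi k i l is the l-th sample of player i at iteration k. *)
Variable xi : forall k : nat, 'I_N -> 'I_(S k) -> {RV Pr >-> Rvec R m}.
Arguments xi : clear implicits.

(* Defined for all k: the random index Rv below only selects the iterate that is
   output. *)
Fixpoint iterate (k : nat) (w : Om) : profile :=
  if k is k'.+1 then
    let x := iterate k' w in
    \mxrow_i proj (@X_ i)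
      (submxrow x i - gamma k' *: batch_grad i x (fun l => xi k' i l w))
  else x0.

Definition G (k : nat) (w : Om) : profile :=
  residual (gamma k) (iterate k w) (gradF (iterate k w)).

Definition Gt (k : nat) (w : Om) : profile :=
  residual (gamma k) (iterate k w)
    (batch_gradF (iterate k w) (fun i l => xi k i l w)).

(* sigma-algebra generated by all the samples of the iterations j with K j *)
Definition sigma_samples (K : set nat) : set (set Om) :=
  <<s [set A | exists j i l, K j /\ g_sigma_algebra_preimage (xi j i l) A] >>.

Definition sigma_iterate (k : nat) : set (set Om) :=
  g_sigma_algebra_preimage (iterate k : Om -> Rvec R (\sum_i n_ i)).

(* For each player the samples of an iteration are i.i.d. and fresh, that is,
   mutually independent together with the history (the None component);
   independence across players is not required. *)
Record rsg_scheme (T : nat) (pR : nat -> R) (Rv : {RV Pr >-> nat}) : Prop :=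
  RsgScheme {
  start_feasible : feasible x0;
  batch_gt0 : forall k, (0 < S k)%N;
  sample_law : forall k i l (B : set (Rvec R m)), measurable B ->
    distribution Pr (xi k i l) B = distribution Q xi0 B;
  sample_fresh : forall k i,
    mutually_independent Pr (fun o : option 'I_(S k) =>
      if o is Some l then g_sigma_algebra_preimage (xi k i l)
      else sigma_samples [set j | (j < k)%N]);
  output_pmf : forall k, Pr (Rv @^-1` [set k]) = (pR k)%:E;
  output_support : forall k, ~~ (1 <= k <= T)%N -> pR k = 0;
  output_independent :
    mutually_independent Pr (fun b : bool =>
      if b then g_sigma_algebra_preimage Rv else sigma_samples setT) }.

(* E[ grad_i ft_i(x^k, xi) | x^k ] = grad_i f_i(x^k), coordinatewise. *)
Definition unbiased_oracle (T : nat) : Prop :=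
  forall k, (k <= T)%N -> forall i (l : 'I_(S k)) j,
    is_cond_exp Pr (sigma_iterate k)
      (fun w => pgrad (fun y => ft i y (xi k i l w)) i (iterate k w) 0 j)
      (fun w => pgrad (expected_cost i) i (iterate k w) 0 j).

(* E[ |grad_i ft_i(x^k, xi) - grad_i f_i(x^k)|^2 | x^k ] <= sigma^2 a.s. *)
Definition bounded_variance_oracle (T : nat) (sigma : R) : Prop :=
  forall k, (k <= T)%N -> forall i (l : 'I_(S k)),
    exists V : Om -> R,
      is_cond_exp Pr (sigma_iterate k)
        (fun w => enorm (pgrad (fun y => ft i y (xi k i l w)) i (iterate k w)
                         - pgrad (expected_cost i) i (iterate k w)) ^+ 2)
        V /\
      {ae Pr, forall w, V w <= sigma ^+ 2}.

End Scheme.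
End Cost.
End Game.

(* Main.v *)
(* Write x = x^k, F for the exact and F + e for the sampled gradient, G and Gt
   for the corresponding residuals and g for the stepsize. The descent lemma for
   the potential P, the inequality <F + e, Gt> >= |Gt|^2 of the projection and
   |Gt - G| <= |e| give, pointwise,
     (g - L g^2 / 2) |Gt|^2 <= P(x^k) - P(x^(k+1)) + g <e, G> + g |e|^2.
   The potential terms telescope. The term <e, G> has mean 0, because e has
   conditional mean 0 given x^k and G is a bounded function of x^k: one step of
   the exact scheme decreases P by at least g |G|^2 / 2. Finally
   E |e|^2 <= sigma^2 N / S_k, because the errors of two distinct samples of a
   batch are uncorrelated.

   Conditional expectations and independence enter only through the statement
   that an integrable h satisfies E[h 1_A] = 0 for all A in a sigma-algebra; it
   suffices to check this on a generating pi-system, and it implies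
   E[h g] = 0 for every measurable g with h g integrable. *)

Require Import Defs.
From mathcomp Require Import all_boot all_order all_algebra.
From mathcomp Require Import all_classical all_reals all_analysis.
From mathcomp Require Import measurable_realfun ring lra.
Set Implicit Arguments.
Unset Strict Implicit.
Unset Printing Implicit Defensive.
Import Order.TTheory GRing.Theory Num.Theory.
Import numFieldNormedType.Exports.
Import HBNNSimple.
Local Open Scope classical_set_scope.
Local Open Scope ring_scope.

(** * Euclidean geometry and projections *)

Section DotProduct.
Context {R : realType} {n : nat}.
Implicit Types (x y z v : 'rV[R]_n) (A : set 'rV[R]_n).

(** The error is paired with G rather than Gt because Gt depends on the same samples as e. Two
    coefficients meet in part (i): descent yields g - L g^2 / 2, whereas the output weights are
    proportional to the smaller g - L g^2. The former is at least g / 2 for every g <= 1/L, so the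
    one-step inequality also proves that |Gt|^2 is integrable, which is not among the assumptions.
    The output index ranges over 1..T, so the telescope starts at x^1 and leaves P(x^1) - P(x^(T+1))
    <= Pmax - Pmin = L D^2. For part (ii), |G|^2 <= 2 |Gt|^2 + 2 |e|^2 and g = 1/(2L) turn the
    summed inequality into the bound 8 L^2 D^2 / T + 6 sigma^2 N / S. Exhausting the budget forces T
    >= M / (2 N S), and up to rounding the prescribed S is the value at which the two resulting
    terms are equal. *)

Definition dot x y : R := \sum_j x 0 j * y 0 j.

Lemma coordB x y j : (x - y) 0 j = x 0 j - y 0 j.
Proof. by rewrite !mxE. Qed.

Lemma dotC x y : dot x y = dot y x.
Proof. by apply: eq_bigr => j _; rewrite mulrC. Qed.

Lemma dotDl x y z : dot (x + y) z = dot x z + dot y z.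
Proof. by rewrite -big_split; apply: eq_bigr => j _; rewrite mxE mulrDl. Qed.

Lemma dotZl (a : R) x y : dot (a *: x) y = a * dot x y.
Proof. by rewrite mulr_sumr; apply: eq_bigr => j _; rewrite mxE mulrA. Qed.

Lemma dotNl x y : dot (- x) y = - dot x y.
Proof. by rewrite -scaleN1r dotZl mulN1r. Qed.

Lemma dotBl x y z : dot (x - y) z = dot x z - dot y z.
Proof. by rewrite dotDl dotNl. Qed.

Lemma dotDr x y z : dot x (y + z) = dot x y + dot x z.
Proof. by rewrite !(dotC x) dotDl. Qed.

Lemma dotZr (a : R) x y : dot x (a *: y) = a * dot x y.
Proof. by rewrite !(dotC x) dotZl. Qed.

Lemma dotNr x y : dot x (- y) = - dot x y.
Proof. by rewrite !(dotC x) dotNl. Qed.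

Lemma dotBr x y z : dot x (y - z) = dot x y - dot x z.
Proof. by rewrite !(dotC x) dotBl. Qed.

Definition dotE := (dotDl, dotDr, dotNl, dotNr, dotZl, dotZr).

Lemma dot0l x : dot 0 x = 0.
Proof. by rewrite -(scale0r x) dotZl mul0r. Qed.

Lemma dot_suml (I : finType) (F : I -> 'rV[R]_n) y :
  dot (\sum_i F i) y = \sum_i dot (F i) y.
Proof.
by elim/big_rec2: _ => [|i a b _ <-]; rewrite ?dot0l// dotDl.
Qed.

Lemma dotB_sqr x y : dot (x - y) (x - y) = dot x x - 2 * dot x y + dot y y.
Proof. by rewrite !dotE (dotC y x); ring. Qed.

Lemma dot_ge0 x : 0 <= dot x x.
Proof. by apply: sumr_ge0 => j _; rewrite -expr2 sqr_ge0. Qed.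

Lemma enorm_sqr x : enorm x ^+ 2 = dot x x.
Proof.
rewrite sqr_sqrtr; first by apply: eq_bigr => j _; rewrite expr2.
by apply: sumr_ge0 => j _; rewrite sqr_ge0.
Qed.

Lemma enorm_ge0 x : 0 <= enorm x.
Proof. exact: sqrtr_ge0. Qed.

Lemma enorm_le x y : (enorm x <= enorm y) = (dot x x <= dot y y).
Proof. by rewrite -!enorm_sqr ler_sqr// nnegrE enorm_ge0. Qed.

(** Parallelogram identity: [2|x|^2 + 2|x - y|^2 - |y|^2 = |2x - y|^2]. *)
Lemma dot_le_double x y z : dot (x - y) (x - y) <= dot z z ->
  dot y y <= 2 * dot x x + 2 * dot z z.
Proof.
have := dot_ge0 (2 *: x - y).
by rewrite !dotB_sqr !dotZr !dotZl; lra.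
Qed.

Lemma dot_eq0 x : dot x x = 0 -> x = 0.
Proof.
move=> x0; apply/rowP => j; rewrite mxE; apply/eqP.
have : (x 0 j * x 0 j == 0).
  rewrite eq_le -{2}expr2 sqr_ge0 andbT -x0 /dot (bigD1 j)//= lerDl.
  by apply: sumr_ge0 => i _; rewrite -expr2 sqr_ge0.
by rewrite mulf_eq0 orbb.
Qed.

Lemma cauchy_schwarz x y : dot x y <= enorm x * enorm y.
Proof.
have [x0|x0] := eqVneq (enorm x) 0.
  have -> : x = 0 by apply: dot_eq0; rewrite -enorm_sqr x0 expr0n.
  by rewrite dot0l mulr_ge0// enorm_ge0.
have [y0|y0] := eqVneq (enorm y) 0.
  have -> : y = 0 by apply: dot_eq0; rewrite -enorm_sqr y0 expr0n.
  by rewrite dotC dot0l mulr_ge0// enorm_ge0.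
have xy0 : 0 < enorm x * enorm y.
  by rewrite mulr_gt0// lt_neqAle eq_sym ?x0 ?y0 enorm_ge0.
rewrite -(ler_pM2l xy0) -subr_ge0.
(* This square equals [2 |x| |y| (|x| |y| - dot x y)]; hence the separate treatment of zero
   norms. *)
have := dot_ge0 (enorm y *: x - enorm x *: y).
rewrite !dotE -!enorm_sqr (dotC y x); nra.
Qed.

Lemma coord_le_enorm x j : `|x 0 j| <= enorm x.
Proof.
rewrite -ler_sqr ?nnegrE ?enorm_ge0//= real_normK ?num_real// enorm_sqr.
rewrite /dot (bigD1 j)//= expr2 lerDl.
by apply: sumr_ge0 => i _; rewrite -expr2 sqr_ge0.
Qed.

Lemma coord_le_norm x j : `|x 0 j| <= `|x|.
Proof.
rewrite [leRHS]mx_normrE.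
exact: (@le_bigmax _ _ _ 0 (fun ij => `|x ij.1 ij.2|) (0, j)).
Qed.

Lemma norm_le_coord x (a : R) : 0 <= a -> (forall j, `|x 0 j| <= a) -> `|x| <= a.
Proof.
move=> a0 xa; rewrite [leLHS]mx_normrE; apply: bigmax_le => // -[i j] _ /=.
by rewrite ord1.
Qed.

Lemma norm_le_enorm x : `|x| <= enorm x.
Proof. by apply: norm_le_coord => [|j]; rewrite ?enorm_ge0 ?coord_le_enorm. Qed.

(** The constant is crude but positive even in dimension 0, as [lipschitz_cvg] requires. *)
Lemma enorm_le_norm x : enorm x <= n.+1%:R * `|x|.
Proof.
rewrite -ler_sqr ?nnegrE ?enorm_ge0 ?mulr_ge0//= enorm_sqr /dot.
apply: (@le_trans _ _ (\sum_(j < n) `|x| ^+ 2)).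
  apply: ler_sum => j _; rewrite -expr2 -[leLHS]real_normK ?num_real//.
  rewrite ler_sqr ?nnegrE//.
  exact: coord_le_norm.
rewrite sumr_const card_ord -[leLHS]mulr_natl exprMn ler_wpM2r ?sqr_ge0//.
by rewrite -natrX ler_nat (leq_trans (leqnSn n))// leq_pmulr.
Qed.

Lemma enormD x y : enorm (x + y) <= enorm x + enorm y.
Proof.
rewrite -ler_sqr ?nnegrE ?addr_ge0 ?enorm_ge0// sqrrD !enorm_sqr !dotE (dotC y x).
have := cauchy_schwarz x y; lra.
Qed.

Lemma enormN x : enorm (- x) = enorm x.
Proof. by apply/eqP; rewrite eq_le !enorm_le !dotE !opprK !lexx. Qed.

Lemma enormZ (a : R) x : enorm (a *: x) = `|a| * enorm x.
Proof.
apply/eqP; rewrite -(@eqrXn2 _ 2) ?mulr_ge0 ?enorm_ge0// exprMn !enorm_sqr.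
by rewrite dotZl dotZr mulrA real_normK ?num_real// -expr2.
Qed.

Lemma enormB_dist x y z : `|enorm (x - y) - enorm (x - z)| <= enorm (y - z).
Proof.
have := enormD (x - y) (y - z); have := enormD (x - z) (z - y).
rewrite -(enormN (z - y)) opprB !addrA !subrK ler_norml => H1 H2; lra.
Qed.

Lemma segment_in A x y (t : R) : convex_set A -> A x -> A y -> 0 <= t <= 1 ->
  A (x + t *: (y - x)).
Proof.
move=> cA Ax Ay /andP[t0 t1].
have l01 : Itv.spec (@Itv.num_sem R) (Itv.Real `[0%Z, 1%Z]) t.
  by rewrite /Itv.num_sem/= num_real in_itv/= t0 t1.
have := cA y x (@Itv.mk _ _ _ t l01).
rewrite !in_setE => /(_ Ay Ax).
rewrite [conv _ _ _](_ : _ = x + t *: (y - x))//.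
rewrite /conv/= scalerBr scalerBl scale1r.
by rewrite addrCA.
Qed.

End DotProduct.

Lemma lipschitz_cvg (R : realType) (V W : normedModType R) (f : V -> W) (k : R)
    (x : V) : 0 < k -> (forall y, `|f x - f y| <= k * `|x - y|) ->
  f z @[z --> x] --> f x.
Proof.
move=> k0 fk; apply/cvgrPdist_le => e e0; near=> y.
rewrite (le_trans (fk y))// -ler_pdivlMl//.
near: y; apply: cvgr_dist_le; first exact: cvg_id.
by rewrite mulr_gt0// invr_gt0.
Unshelve. all: by end_near. Qed.

Section Projection.
Context {R : realType} {n : nat}.
Implicit Types (x y z p q v : 'rV[R]_n) (A : set 'rV[R]_n).

(** The variational characterization of the projection. Unlike minimality it is linear in the test
    point, so inequalities for several points, or for several blocks, can simply be added. *)
Definition is_proj A x p := A p /\ forall z, A z -> dot (x - p) (z - p) <= 0.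

Lemma is_proj_min A x p : is_proj A x p ->
  forall z, A z -> enorm (x - p) <= enorm (x - z).
Proof.
move=> [Ap xp] z Az; rewrite enorm_le.
have -> : x - z = (x - p) - (z - p) by rewrite opprB addrA subrK.
have := xp z Az; have := dot_ge0 (z - p).
by rewrite (dotB_sqr (x - p)); lra.
Qed.

(* Minimality along the segment from p to z. *)
Lemma min_is_proj A x p : convex_set A -> A p ->
  (forall z, A z -> enorm (x - p) <= enorm (x - z)) -> is_proj A x p.
Proof.
move=> cA Ap pmin; split => // z Az.
have H t : 0 < t <= 1 -> 2 * dot (x - p) (z - p) <= t * dot (z - p) (z - p).
  move=> /andP[t0 t1]; have := pmin _ (segment_in cA Ap Az (t := t) _).
  rewrite (ltW t0) t1 => /(_ isT); rewrite enorm_le.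
  have -> : x - (p + t *: (z - p)) = (x - p) - t *: (z - p) by rewrite opprD addrA.
  rewrite (dotB_sqr (x - p)) !dotZr dotZl => H.
  rewrite -(ler_pM2l t0); lra.
rewrite leNgt; apply/negP => d0.
have := dot_ge0 (z - p); rewrite le_eqVlt => /orP[/eqP e|e].
  by have := H 1; rewrite ltr01 lexx -e => /(_ isT); lra.
(* For this step length [t |z - p|^2] is at most the inner product, while [H] bounds it below by
   twice that positive number. *)
have := H (Num.min 1 (dot (x - p) (z - p) / dot (z - p) (z - p))).
rewrite lt_min ltr01 divr_gt0// ge_min lexx => /(_ isT).
apply/negP; rewrite -ltNge.
apply: (@le_lt_trans _ _ (dot (x - p) (z - p))); last lra.
by rewrite -ler_pdivlMr// ge_min lexx orbT.
Qed.

(** Firm nonexpansiveness: the sum of the two variational inequalities, each tested at the other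
    projection. *)
Lemma is_proj_contraction A x y p q : is_proj A x p -> is_proj A y q ->
  dot (p - q) (p - q) <= dot (x - y) (p - q).
Proof.
move=> [Ap xp] [Aq yq]; have := xp q Aq; have := yq p Ap.
by rewrite !dotE; lra.
Qed.

Lemma is_proj_nonexpansive A x y p q : is_proj A x p -> is_proj A y q ->
  enorm (p - q) <= enorm (x - y).
Proof.
move=> xp yq; have [->|pq0] := eqVneq (enorm (p - q)) 0; first exact: enorm_ge0.
rewrite -(ler_pM2r (_ : 0 < enorm (p - q))); last first.
  by rewrite lt_neqAle eq_sym pq0 enorm_ge0.
rewrite -expr2 enorm_sqr.
exact: le_trans (is_proj_contraction xp yq) (cauchy_schwarz _ _).
Qed.

Lemma is_proj_unique A x p q : is_proj A x p -> is_proj A x q -> p = q.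
Proof.
move=> xp xq; apply/subr0_eq/dot_eq0/eqP; rewrite eq_le dot_ge0 andbT.
by rewrite (le_trans (is_proj_contraction xp xq))// subrr dot0l.
Qed.

(** [proj] is an arbitrary choice among the minimizers, but every minimizer solves the variational
    inequality, whose solution is unique. *)
Lemma is_proj_proj A x p : convex_set A -> is_proj A x p -> Defs.proj A x = p.
Proof.
move=> cA xp; apply: (is_proj_unique (A := A) (x := x)) => //.
have : [set y | A y /\ forall z, A z -> enorm (x - y) <= enorm (x - z)] p.
  by split; [case: xp | exact: is_proj_min].
by move=> xp'; have [] := getPex (ex_intro _ p xp'); exact: min_is_proj.
Qed.

Lemma closest_point_exists A x : closed A -> A !=set0 ->
  exists2 p, A p & forall z, A z -> enorm (x - p) <= enorm (x - z).
Proof.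
move=> clA [a Aa]; pose f y := enorm (x - y).
have cf : continuous f.
  suff H (y : 'rV[R]_n) : f z @[z --> y] --> f y by exact: H.
  apply: (@lipschitz_cvg _ _ _ f n.+1%:R) => // z.
  by rewrite (le_trans (enormB_dist _ _ _))// enorm_le_norm.
(* [A] may be unbounded; cutting it at the level of a known point gives compactness and loses no
   minimizer. *)
pose B := A `&` [set y | f y <= f a].
have cB : compact B.
  apply: bounded_closed_compact.
    exists (`|x| + f a); split; first exact: num_real.
    move=> e /ltW le_e y [_ /= fy]; apply: le_trans le_e.
    have -> : y = x - (x - y) by rewrite opprB addrC subrK.
    by rewrite (le_trans (ler_normB _ _))// lerD2l (le_trans (norm_le_enorm _)).
  apply: closedI => //.
  exact: (preimage_closed (fun y _ => cf y) (@closed_le R (f a))).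
have [|p /set_mem[Ap fp] pmin] := compact_EVT_min _ cB (continuous_subspaceT cf).
  by exists a; split => //=.
exists p => // z Az; have [fz|/ltW fz] := leP (f z) (f a).
  by apply: pmin; apply/mem_set; split.
exact: le_trans fp fz.
Qed.

Lemma projP A x : closed A -> convex_set A -> A !=set0 ->
  is_proj A x (Defs.proj A x).
Proof.
move=> clA cA A0; have [p Ap pmin] := closest_point_exists x clA A0.
have xp := min_is_proj cA Ap pmin.
by rewrite (is_proj_proj cA xp).
Qed.

Lemma proj_continuous A : closed A -> convex_set A -> A !=set0 ->
  continuous (Defs.proj A).
Proof.
move=> clA cA A0.
suff H (x : 'rV[R]_n) : Defs.proj A z @[z --> x] --> Defs.proj A x by exact: H.
apply: (@lipschitz_cvg _ _ _ _ n.+1%:R) => // y.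
rewrite (le_trans (norm_le_enorm _))// (le_trans _ (enorm_le_norm _))//.
exact: is_proj_nonexpansive (projP _ clA cA A0) (projP _ clA cA A0).
Qed.

(** The variational inequality tested at the current point [x]. With [x - p] equal to [g] times the
    residual it becomes [residual_le]. *)
Lemma is_proj_step A x v p (g : R) : 0 < g -> A x -> is_proj A (x - g *: v) p ->
  g^-1 * dot (x - p) (x - p) <= dot v (x - p).
Proof.
move=> g0 Ax [_ /(_ x Ax)].
rewrite addrAC (dotBl (x - p)) (dotZl g) subr_le0.
by rewrite ler_pdivrMl.
Qed.

End Projection.

(** * Gradients and potentials *)

Section Gradient.
Context {R : realType} {n : nat}.
Implicit Types (x y v : 'rV[R]_n) (A : set 'rV[R]_n) (f : 'rV[R]_n -> R).

Lemma derive_gradient f x v : differentiable f x ->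
  'D_v f x = dot (gradient f x) v.
Proof.
move=> df; rewrite deriveE// {1}(row_sum_delta v) linear_sum.
apply: eq_bigr => j _; rewrite linearZ/= mxE deriveE//.
by rewrite mulrC.
Qed.

Lemma is_derive_line f x v (t : R) : differentiable f (x + t *: v) ->
  is_derive t (1 : R) (fun s : R => f (x + s *: v))
    (dot (gradient f (x + t *: v)) v).
Proof.
move=> df.
have E : (fun h : R => h^-1 *: (((fun s : R => f (x + s *: v)) \o shift t) (h *: 1)
      - f (x + t *: v))) =
    (fun h : R => h^-1 *: ((f \o shift (x + t *: v)) (h *: v) - f (x + t *: v))).
  apply/funext => h /=; congr (_ *: (f _ - _)).
  by rewrite [h *: 1]mulr1 scalerDl addrCA.
apply: DeriveDef.
  by rewrite /derivable E; exact: diff_derivable.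
by rewrite /derive E -derive_gradient.
Qed.

(** Subtracting the quadratic model along the segment leaves [psi], whose derivative is nonpositive
    by the Lipschitz bound and Cauchy-Schwarz. The mean value theorem then gives [psi 1 <= psi 0],
    with no integral of the gradient; convexity keeps the whole segment inside [A], where [f] is
    differentiable. *)
Lemma descent f A (L : R) x y : convex_set A -> Lsmooth_on L A f ->
  A x -> A y ->
  f y <= f x + dot (gradient f x) (y - x) + L / 2 * dot (y - x) (y - x).
Proof.
move=> cA [[df _] fL] Ax Ay; set v := y - x.
have Av (t : R) : 0 <= t <= 1 -> A (x + t *: v) by exact: segment_in.
pose psi (t : R) := f (x + t *: v) - dot (gradient f x) v * t - L / 2 * dot v v * t ^+ 2.
pose dpsi (t : R) := dot (gradient f (x + t *: v)) v - dot (gradient f x) v - L * dot v v * t.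
have dpsiP (t : R) : 0 <= t <= 1 -> is_derive t (1 : R) psi (dpsi t).
  move=> t01; have H1 := is_derive_line (df _ (Av t t01)).
  have H2 : is_derive t (1 : R) (fun s : R => dot (gradient f x) v * s) (dot (gradient f x) v).
    by apply: is_derive_eq; rewrite /= [_ *: 1]mulr1.
  have H3 : is_derive t (1 : R) (fun s : R => L / 2 * dot v v * s ^+ 2) (L * dot v v * t).
    apply: is_derive_eq; rewrite /= ?scaler0 ?addr0 /GRing.scale/=.
    by field.
  exact: is_deriveB.
have [||t] := @MVT R psi dpsi 0 1 ltr01 _ _.
- by move=> t; rewrite in_itv/= => /andP[/ltW t0 /ltW t1]; apply: dpsiP; rewrite t0.
- apply: derivable_within_continuous => t; rewrite in_itv/= => t01.
  by have [] := dpsiP t t01.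
rewrite in_itv/= subr0 mulr1 => /andP[t0 t1].
rewrite {1 2}/psi scale1r scale0r addr0 mulr1 !mulr0 expr1n expr0n/= ?mulr0 !subr0 ?mulr1.
have -> : x + v = y by rewrite addrC subrK.
have : dpsi t <= 0.
  rewrite /dpsi -dotBl.
  have := cauchy_schwarz (gradient f (x + t *: v) - gradient f x) v.
  have At : A (x + t *: v) by apply: Av; rewrite !ltW.
  have := fL _ _ At Ax; rewrite addrAC subrr add0r.
  have -> : enorm (t *: v) = t * enorm v.
    by rewrite enormZ gtr0_norm.
  move=> H1 H2; rewrite -enorm_sqr subr_le0 (le_trans H2)//.
  rewrite (le_trans (ler_wpM2r (enorm_ge0 _) H1))// expr2.
  by rewrite (_ : L * _ * _ = L * (enorm v * enorm v) * t)//; ring.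
by move=> H /eqP; rewrite subr_eq => /eqP e; lra.
Qed.

End Gradient.

Section Blocks.
Context {R : realType} {N : nat} {n_ : 'I_N -> nat}.
Notation profile := 'rV[R]_(\sum_i n_ i).
Implicit Types (x y : profile).
Variable X_ : forall i, set 'rV[R]_(n_ i).

Lemma dotE_mul n (x y : 'rV[R]_n) : dot x y = (x *m y^T) 0 0.
Proof. by rewrite mxE; apply: eq_bigr => j _; rewrite mxE. Qed.

Lemma dot_block x y : dot x y = \sum_i dot (submxrow x i) (submxrow y i).
Proof.
rewrite dotE_mul -{1}(submxrowK x) -{1}(submxcolK y^T) mul_mxrow_mxcol summxE.
by apply: eq_bigr => i _; rewrite -tr_submxrow dotE_mul.
Qed.

Lemma submxrowZ (a : R) x i : submxrow (a *: x) i = a *: submxrow x i.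
Proof. by apply/rowP => j; rewrite !mxE. Qed.

Lemma feasible_convex : (forall i, convex_set (@X_ i)) -> convex_set (feasible X_).
Proof.
move=> cX x y l; rewrite !in_setE => Xx Xy i.
have := cX i (submxrow x i) (submxrow y i) l; rewrite !in_setE => /(_ (Xx i) (Xy i)).
by rewrite /conv/= submxrowD !submxrowZ.
Qed.

(** The variational inequalities of the blocks add up. Thus the separate projections of the players
    in the scheme form the single projection that occurs in the residuals. *)
Lemma is_proj_feasible x p :
  (forall i, is_proj (@X_ i) (submxrow x i) (submxrow p i)) ->
  is_proj (feasible X_) x p.
Proof.
move=> H; split=> [i|z Xz]; first by have [] := H i.
rewrite dot_block; apply: sumr_le0 => i _; rewrite !submxrowB.
by have [_] := H i; apply; exact: Xz.
Qed.

Definition embed i (v : 'rV[R]_(n_ i)) : profile :=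
  \mxrow_j dfwith (fun j => 0 : 'rV[R]_(n_ j)) i v j.

Lemma submxrow_embed i (v : 'rV[R]_(n_ i)) j :
  submxrow (embed v) j = dfwith (fun j => 0 : 'rV[R]_(n_ j)) i v j.
Proof. by rewrite mxrowK. Qed.

Lemma submxrow_replace x i (u : 'rV[R]_(n_ i)) j :
  submxrow (replace x u) j = dfwith (fun j => submxrow x j) i u j.
Proof. by rewrite mxrowK. Qed.

(** A unilateral deviation is a translation along [embed v], which matches difference quotients in
    the block variable with those of a function of the whole profile. *)
Lemma replace_shift x i (v : 'rV[R]_(n_ i)) :
  replace x (v + submxrow x i) = embed v + x.
Proof.
apply/mxrowP => j; rewrite submxrowD submxrow_embed submxrow_replace.
case: dfwithP => [|k ik]; first by rewrite dfwithin.
by rewrite dfwithout// add0r.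
Qed.

Lemma embedZ (a : R) i (v : 'rV[R]_(n_ i)) : embed (a *: v) = a *: embed v.
Proof.
apply/mxrowP => j; rewrite submxrowZ !submxrow_embed.
by case: dfwithP => [|k ik]; rewrite ?dfwithin// dfwithout// scaler0.
Qed.

Lemma embed0 i : embed (0 : 'rV[R]_(n_ i)) = 0.
Proof. by rewrite -[X in embed X](scale0r 0) embedZ scale0r. Qed.

Lemma embed_sum x : x = \sum_i embed (submxrow x i).
Proof.
apply/mxrowP => j; rewrite submxrow_sum (bigD1 j)//= submxrow_embed dfwithin.
rewrite big1 ?addr0// => i ij.
by rewrite submxrow_embed dfwithout.
Qed.

End Blocks.

Section Potential.
Context {R : realType} {N : nat} {n_ : 'I_N -> nat}.
Notation profile := 'rV[R]_(\sum_i n_ i).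
Implicit Types (x y : profile).
Variable X_ : forall i, set 'rV[R]_(n_ i).
Hypothesis X_convex : forall i, convex_set (@X_ i).

(* X may have empty interior, so only the derivatives along feasible segments
   of P and of the costs agree. *)
Lemma potential_derive (f : 'I_N -> profile -> R) (P : profile -> R) x y i :
  is_potential X_ f P -> feasible X_ x -> feasible X_ y ->
  differentiable P x ->
  differentiable (fun u => f i (replace x u)) (submxrow x i) ->
  'D_(embed (submxrow (y - x) i)) P x =
  'D_(submxrow (y - x) i) (fun u => f i (replace x u)) (submxrow x i).
Proof.
move=> potP Xx Xy dP df; set v := submxrow (y - x) i.
(* Right-hand limits, because [x + h (y - x)] is known to be feasible only for [0 <= h <= 1]. *)
have HP : h^-1 *: ((P \o shift x) (h *: embed v) - P x) @[h --> 0^'+]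
    --> 'D_(embed v) P x.
  by apply: (cvg_dnbhs_at_right (diff_derivable (v := embed v) dP)).
have Hf : h^-1 *: (((fun u => f i (replace x u)) \o shift (submxrow x i)) (h *: v)
      - f i (replace x (submxrow x i))) @[h --> 0^'+]
    --> 'D_v (fun u => f i (replace x u)) (submxrow x i).
  by apply: (cvg_dnbhs_at_right (diff_derivable (v := v) df)).
apply: (cvg_unique _ HP); first exact: norm_hausdorff.
apply: cvg_trans Hf; apply: near_eq_cvg; near=> h => /=.
have x0 : replace x (submxrow x i) = x.
  by have := replace_shift x (0 : 'rV_(n_ i)); rewrite embed0 !add0r.
have Xh : X_ (h *: v + submxrow x i).
  rewrite addrC /v submxrowB; apply: segment_in => //.
  by apply/andP; split; near: h; [exact: nbhs_right_ge|exact: nbhs_right_le].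
have := potP i x _ _ Xx Xh (Xx i).
by rewrite x0 replace_shift embedZ => ->.
Unshelve. all: by end_near. Qed.

(** Splitting [y - x] into its blocks reduces the claim to unilateral deviations. In the descent
    inequality the gradient of [P] is paired only with such differences of feasible points, so [F]
    can replace it there. *)
Lemma potential_gradient (f : 'I_N -> profile -> R) (P : profile -> R) x y :
  is_potential X_ f P -> feasible X_ x -> feasible X_ y ->
  differentiable P x ->
  (forall i, differentiable (fun u => f i (replace x u)) (submxrow x i)) ->
  dot (gradient P x) (y - x) = dot (\mxrow_i pgrad (f i) i x) (y - x).
Proof.
move=> potP Xx Xy dP df; rewrite {1}(embed_sum (y - x)) dotC dot_suml dot_block.
apply: eq_bigr => i _; rewrite mxrowK /pgrad -derive_gradient//.
by rewrite -(potential_derive potP)// derive_gradient// dotC.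
Qed.

End Potential.

(** * Integrals, orthogonality to a sigma-algebra, independence *)

Section RealIntegral.
Context d (T : measurableType d) (R : realType) (P : probability T R).
Implicit Types (f g h : T -> R) (A B : set T) (G : set (set T)).
Notation L1 f := (P.-integrable setT (EFin \o f)).

Lemma L1_cst (c : R) : L1 (fun=> c).
Proof. exact: finite_measure_integrable_cst. Qed.

Lemma L1D f g : L1 f -> L1 g -> L1 (fun w => f w + g w).
Proof. by move=> If Ig; exact: (integrableD measurableT If Ig). Qed.

Lemma L1B f g : L1 f -> L1 g -> L1 (fun w => f w - g w).
Proof. by move=> If Ig; exact: (integrableB measurableT If Ig). Qed.

Lemma L1Z (k : R) f : L1 f -> L1 (fun w => k * f w).
Proof. by move=> If; exact: (integrableZl measurableT k If). Qed.

Lemma L1_sum (I : Type) (s : seq I) (F : I -> T -> R) :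
  (forall i, L1 (F i)) -> L1 (fun w => \sum_(i <- s) F i w).
Proof.
move=> IF; elim: s => [|i s IH].
  by under [X in EFin \o X]eq_fun do rewrite big_nil; exact: L1_cst.
by under [X in EFin \o X]eq_fun do rewrite big_cons; exact: L1D.
Qed.

Lemma L1_measurable f : L1 f -> measurable_fun setT f.
Proof. by move=> /integrableP[/measurable_EFinP]. Qed.

Lemma L1_le f g : measurable_fun setT f -> (forall w, `|f w| <= g w) -> L1 g ->
  L1 f.
Proof.
move=> mf fg; apply: le_integrable => //; first exact/measurable_EFinP.
by move=> w _ /=; rewrite lee_fin (le_trans (fg w))// ler_norm.
Qed.

Lemma L1_bounded f (c : R) : measurable_fun setT f -> (forall w, `|f w| <= c) ->
  L1 f.
Proof. by move=> mf fc; apply: (L1_le mf fc); exact: L1_cst. Qed.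

Lemma L1M_bounded f g (c : R) : L1 f -> measurable_fun setT g ->
  (forall w, `|g w| <= c) -> L1 (fun w => f w * g w).
Proof.
move=> If mg gc.
apply: (@L1_le _ (fun w => c * `|f w|)).
- by apply: measurable_funM => //; exact: L1_measurable.
- by move=> w; rewrite normrM mulrC ler_wpM2r.
- by apply: L1Z; exact: integrable_norm.
Qed.

Lemma L1_indic f A : measurable A -> L1 f -> L1 (fun w => f w * \1_A w).
Proof.
move=> mA If; apply: (@L1M_bounded _ _ 1) => // w.
by rewrite ger0_norm// indicE lern1 leq_b1.
Qed.

Lemma EFin_Rintegral f : L1 f -> (\int[P]_w (f w)%:E = (\int[P]_w f w)%:E)%E.
Proof. by move=> If; rewrite fineK// integrable_fin_num. Qed.

Lemma Rintegral_indic f A :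
  \int[P]_(w in A) f w = \int[P]_w (f w * \1_A w).
Proof. by rewrite Rintegral_mkcond patch_indic. Qed.

Lemma Rintegral_sum (I : Type) (s : seq I) (F : I -> T -> R) :
  (forall i, L1 (F i)) ->
  \int[P]_w (\sum_(i <- s) F i w) = \sum_(i <- s) \int[P]_w F i w.
Proof.
move=> IF; elim: s => [|i s IH].
  under eq_Rintegral do rewrite big_nil.
  by rewrite big_nil Rintegral_cst// mul0r.
under eq_Rintegral do rewrite big_cons.
by rewrite big_cons RintegralD// ?IH//; exact: L1_sum.
Qed.

Definition orthogonal_to G h :=
  forall A, <<s G >> A -> \int[P]_w (h w * \1_A w) = 0.

Lemma g_sigma_algebra_measurable G A :
  G `<=` measurable -> <<s G >> A -> d.-measurable A.
Proof.
by move=> Gm; apply: smallest_sub => //; exact: sigma_algebra_measurable.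
Qed.

Lemma orthogonal_to_pi G h : L1 h -> G `<=` measurable -> setI_closed G ->
  G setT -> (forall A, G A -> \int[P]_w (h w * \1_A w) = 0) ->
  orthogonal_to G h.
Proof.
move=> Ih Gm GI GT G0.
have mG (A : set (g_sigma_algebraType G)) :
      measurable A -> d.-measurable A.
  exact: g_sigma_algebra_measurable.
apply: (@dynkin_induction _ (g_sigma_algebraType G) G) => //.
- exact: G0.
- move=> A /mG mA hA.
  (* The complement is where [G setT] enters: it says that [h] has mean 0. *)
  have E w : h w * \1_(~` A) w = h w * \1_setT w - h w * \1_A w.
    rewrite !indicE in_setC in_setT mulr1.
    by case: (w \in A); rewrite /= ?mulr0 ?mulr1 ?subrr ?subr0.
  under eq_Rintegral do rewrite E.
  by rewrite RintegralB// ?hA ?G0 ?subr0//; apply: L1_indic.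
- move=> F mF tF hF; rewrite -Rintegral_indic /Rintegral integral_bigcup//.
  + rewrite eseries0// => k _ _.
    have := hF k; rewrite -Rintegral_indic /Rintegral => hk.
    (* [hk] concerns [fine] of the integral, which is 0 for infinite values as well; integrability
       of [h] excludes these. *)
    rewrite -[LHS]fineK ?hk// integrable_fin_num//; first exact: mG.
    by apply: (integrableS measurableT) => //; exact: mG.
  + by move=> k; exact: mG.
  + apply: (integrableS measurableT) => //; apply: bigcup_measurable => k _.
    exact: mG.
Qed.

Lemma g_sigma_measurable_funS d' (T' : measurableType d') G G' (f : T -> T') :
  (forall A, G A -> <<s G' >> A) ->
  measurable_fun (setT : set (g_sigma_algebraType G))
    (f : g_sigma_algebraType G -> T') ->
  measurable_fun (setT : set (g_sigma_algebraType G'))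
    (f : g_sigma_algebraType G' -> T').
Proof.
move=> GG' mf _ B mB; have := mf measurableT B mB.
by apply: smallest_sub; [exact: smallest_sigma_algebra|exact: GG'].
Qed.

Lemma g_sigma_measurable_fun d' (T' : measurableType d') G (f : T -> T') :
  G `<=` measurable ->
  measurable_fun (setT : set (g_sigma_algebraType G))
    (f : g_sigma_algebraType G -> T') ->
  measurable_fun setT f.
Proof.
move=> GG' mf _ B mB; have := mf measurableT B mB.
exact: g_sigma_algebra_measurable.
Qed.

Lemma orthogonal_to_nnsfun G h (g : {nnsfun (g_sigma_algebraType G) >-> R}) :
  L1 h -> G `<=` measurable -> orthogonal_to G h -> \int[P]_w (h w * g w) = 0.
Proof.
move=> Ih Gm hG.
have mg y : <<s G >> (g @^-1` [set y]).
  exact: (measurable_funPTI g (measurable_set1 y)).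
have E w : h w * g w =
    \sum_(y <- finmap.enum_fset (fset_set (range g))) y * (h w * \1_(g @^-1` [set y]) w).
  rewrite fimfunE fsbig_finite//= mulr_sumr; apply: eq_bigr => y _.
  by rewrite mulrCA.
under eq_Rintegral do rewrite E.
rewrite Rintegral_sum => [|y].
  rewrite big1_seq// => y _; rewrite RintegralZl ?hG ?mulr0//.
  by apply: L1_indic => //; exact: g_sigma_algebra_measurable (mg y).
by apply: L1Z; apply: L1_indic => //; exact: g_sigma_algebra_measurable (mg y).
Qed.

(** The simple approximations of [g] are taken in the measurable space generated by [G], so that
    their level sets are admissible test sets. Dominated convergence applies with the bound
    [|h g|]. *)
Lemma orthogonal_to_ge0 G h (g : T -> R) :
  G `<=` measurable -> L1 h -> orthogonal_to G h ->
  measurable_fun (setT : set (g_sigma_algebraType G))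
    (g : g_sigma_algebraType G -> R) ->
  (forall w, 0 <= g w) -> L1 (fun w => h w * g w) -> \int[P]_w (h w * g w) = 0.
Proof.
move=> Gm Ih hG mg g0 Ihg.
have mgE : measurable_fun setT (EFin \o (g : g_sigma_algebraType G -> R)).
  exact/measurable_EFinP.
pose gn := nnsfun_approx measurableT mgE.
have gnE n w : 0 <= gn n w <= g w.
  rewrite fun_ge0/= -lee_fin.
  rewrite /gn nnsfun_approxE.
  apply: (@le_approx _ _ _ setT (EFin \o g) n w) => // x _.
  by rewrite lee_fin.
have gncvg w : (EFin \o gn^~ w) n @[n --> \oo] --> (g w)%:E.
  by apply: (cvg_nnsfun_approx measurableT mgE) => // x _; rewrite lee_fin.
have mgn n : measurable_fun setT (gn n : T -> R).
  by apply: (g_sigma_measurable_fun Gm); exact: measurable_funPT.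
have mh := L1_measurable Ih.
have [] := @dominated_convergence _ T R P setT measurableT
  (fun n w => (h w * gn n w)%:E) (EFin \o (fun w => h w * g w))
  (EFin \o (fun w => `|h w * g w|)).
- by move=> n; apply/measurable_EFinP; exact: measurable_funM.
- by apply/measurable_EFinP; exact: L1_measurable.
- apply: aeW => w _; rewrite -[EFin \o _]/(EFin \o _).
  under eq_fun do rewrite EFinM.
  by rewrite /= EFinM; apply: cvgeZl => //; exact: gncvg.
- exact: integrable_norm.
- apply: aeW => w n _ /=; rewrite lee_fin !normrM ler_wpM2l//.
  by have /andP[a b] := gnE n w; rewrite !ger0_norm.
move=> _ _; under eq_fun.
  move=> n; rewrite EFin_Rintegral ?orthogonal_to_nnsfun//; last first.
    apply: (@L1_le _ (fun w => `|h w * g w|)).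
    - exact: measurable_funM.
    - move=> w; rewrite !normrM ler_wpM2l//.
      by have /andP[a b] := gnE n w; rewrite !ger0_norm.
    - exact: integrable_norm.
  over.
rewrite EFin_Rintegral// => /(cvg_lim (@ereal_hausdorff R)).
by rewrite lim_cst// => -[<-].
Qed.

(** Integrability is required of the product because [g] may be unbounded: in [noise_cross] it is
    the error of another sample. The parts [gp] and [gm] keep the bound [|h g|]. *)
Lemma orthogonal_toM G h (g : T -> R) :
  G `<=` measurable -> L1 h -> orthogonal_to G h ->
  measurable_fun (setT : set (g_sigma_algebraType G))
    (g : g_sigma_algebraType G -> R) ->
  L1 (fun w => h w * g w) -> \int[P]_w (h w * g w) = 0.
Proof.
move=> Gm Ih hG mg Ihg; have mg' := g_sigma_measurable_fun Gm mg.
have mh := L1_measurable Ih.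
pose gp w := Num.max (g w) 0; pose gm w := Num.max (- g w) 0.
have E w : h w * g w = h w * gp w - h w * gm w.
  rewrite -mulrBr /gp /gm; congr (_ * _).
  by case: (lerP (g w) 0) => g0; case: (lerP (- g w) 0) => g1; lra.
have Ip : L1 (fun w => h w * gp w).
  apply: (@L1_le _ (fun w => `|h w * g w|)).
  - by apply: measurable_funM => //; exact: measurable_maxr.
  - move=> w; rewrite !normrM ler_wpM2l// /gp.
    by case: (lerP (g w) 0) => // g0; rewrite normr0.
  - exact: integrable_norm.
have Im : L1 (fun w => h w * gm w).
  apply: (@L1_le _ (fun w => `|h w * g w|)).
  - by apply: measurable_funM => //; apply: measurable_maxr => //; exact: measurable_funN.
  - move=> w; rewrite !normrM ler_wpM2l// /gm.
    by case: (lerP (- g w) 0) => // g0; rewrite ?normr0 ?normrN.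
  - exact: integrable_norm.
under eq_Rintegral do rewrite E.
rewrite RintegralB// !(@orthogonal_to_ge0 G) ?subr0//.
- by apply: measurable_maxr => //; exact: measurable_funN.
- by move=> w; rewrite le_max lexx orbT.
- exact: measurable_maxr.
- by move=> w; rewrite le_max lexx orbT.
Qed.

(** Independence of [B] from the pi-system [G] means exactly that the centred indicator [1_B - P(B)]
    is orthogonal to [G]. *)
Lemma Rintegral_indep G (B : set T) (g : T -> R) :
  G `<=` measurable -> setI_closed G -> G setT -> measurable B ->
  (forall A, G A -> (P (A `&` B) = P A * P B)%E) ->
  measurable_fun (setT : set (g_sigma_algebraType G))
    (g : g_sigma_algebraType G -> R) ->
  L1 g -> \int[P]_w (g w * \1_B w) = fine (P B) * \int[P]_w g w.
Proof.
move=> Gm GI GT mB GB mg Ig; pose h w : R := \1_B w - fine (P B).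
have I1 A : measurable A -> L1 (\1_A : T -> R).
  by move=> mA; exact: integrable_indic.
have E1 A : measurable A -> \int[P]_w (\1_A w : R) = fine (P A).
  by move=> mA; rewrite /Rintegral integral_indic// setIT.
have Ih : L1 h by apply: L1B; [exact: I1|exact: L1_cst].
have hG : orthogonal_to G h.
  apply: orthogonal_to_pi => // A GA; have mA := Gm _ GA.
  have E w : h w * \1_A w = \1_(A `&` B) w - fine (P B) * \1_A w.
    by rewrite indicI mulrBl [in LHS]mulrC.
  under eq_Rintegral do rewrite E.
  rewrite RintegralB//; last 2 first.
  - by apply: I1; exact: measurableI.
  - by apply: L1Z; exact: I1.
  rewrite RintegralZl//; last exact: I1.
  rewrite !E1//; last exact: measurableI.
  by rewrite GB// fineM ?fin_num_measure// mulrC subrr.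
have hgE w : h w * g w = g w * \1_B w - fine (P B) * g w.
  by rewrite mulrBl [X in X - _]mulrC.
have Igb : L1 (fun w => g w * \1_B w) by exact: L1_indic.
have Ihg : L1 (fun w => h w * g w).
  by under [X in EFin \o X]eq_fun do rewrite hgE; apply: L1B => //; exact: L1Z.
have := orthogonal_toM Gm Ih hG mg Ihg.
under eq_Rintegral do rewrite hgE.
rewrite RintegralB//; last exact: L1Z.
by rewrite RintegralZl// => /eqP; rewrite subr_eq0 => /eqP.
Qed.

Lemma is_cond_exp_L1 G f g : is_cond_exp P G f g -> L1 (fun w => f w - g w).
Proof. by move=> [If Ig _ _]; exact: L1B. Qed.

Lemma is_cond_exp_orthogonal G f g A : is_cond_exp P G f g ->
  G A -> measurable A -> \int[P]_w ((f w - g w) * \1_A w) = 0.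
Proof.
move=> [If Ig _ /(_ A) fg] GA mA; under eq_Rintegral do rewrite mulrBl.
rewrite RintegralB//; [|exact: L1_indic|exact: L1_indic].
by rewrite -!Rintegral_indic /Rintegral fg// subrr.
Qed.

(** The almost-everywhere comparison of integrals is for nonnegative functions, so [f] is first
    replaced by its positive part, which stays below [c] since [0 <= c]. *)
Lemma ae_Rintegral_le f (c : R) : L1 f -> 0 <= c -> {ae P, forall w, f w <= c} ->
  \int[P]_w f w <= c.
Proof.
move=> If c0 fc; pose g w := Num.max (f w) 0.
have mg : measurable_fun setT g by apply: measurable_maxr => //; exact: L1_measurable.
have Ig : L1 g.
  apply: (@L1_le _ (fun w => `|f w|)) => //; last exact: integrable_norm.
  by move=> w; rewrite /g; case: (lerP (f w) 0) => // ?; rewrite normr0.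
apply: (@le_trans _ _ (\int[P]_w g w)).
  by apply: le_Rintegral => // w _; rewrite le_max lexx.
rewrite -lee_fin -EFin_Rintegral//.
have -> : c%:E = (\int[P]_w c%:E)%E.
  by rewrite integral_cst// [X in (_ * X)%E](@probability_setT _ _ _ P) mule1.
apply: ae_ge0_le_integral => //.
- by move=> w _; rewrite lee_fin le_max lexx orbT.
- exact/measurable_EFinP.
- apply: filterS fc => w fwc _; rewrite lee_fin /g.
  by rewrite ge_max fwc c0.
Qed.

Lemma mutually_independent2 (I : finType) (F : I -> set (set T)) (a b : I) A B :
  mutually_independent P F -> a != b -> F a A -> F b B ->
  (P (A `&` B) = P A * P B)%E.
Proof.
move=> indF ab FA FB; pose E i := if i == a then A else B.
have Ea : E a = A by rewrite /E eqxx.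
have Eb : E b = B by rewrite /E eq_sym (negPf ab).
have := indF [set a; b]%SET E.
rewrite big_setU1 ?big_set1 ?inE// Ea Eb => <-.
  congr (P _); apply/seteqP; split=> [w [Aw Bw] i /=|w /= H].
    by rewrite !inE => /orP[]/eqP->; rewrite ?Ea ?Eb.
  by split; [rewrite -Ea|rewrite -Eb]; apply: H; rewrite /= !inE eqxx ?orbT.
by move=> i; rewrite !inE => /orP[]/eqP->; rewrite ?Ea ?Eb.
Qed.

Lemma mutually_independent3 (I : finType) (F : I -> set (set T)) (a b c : I) A B C :
  mutually_independent P F -> a != b -> a != c -> b != c ->
  F a A -> F b B -> F c C ->
  (P (A `&` B `&` C) = P A * P B * P C)%E.
Proof.
move=> indF ab ac bc FA FB FC.
pose E i := if i == a then A else if i == b then B else C.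
have Ea : E a = A by rewrite /E eqxx.
have Eb : E b = B by rewrite /E eq_sym (negPf ab) eqxx.
have Ec : E c = C by rewrite /E eq_sym (negPf ac) eq_sym (negPf bc).
have := indF (a |: [set b; c])%SET E.
rewrite big_setU1 ?big_setU1 ?big_set1 ?inE ?negb_or ?ab//= Ea Eb Ec muleA => <-.
  congr (P _); apply/seteqP; split=> [w [[Aw Bw] Cw] i /=|w /= H].
    by rewrite !inE => /or3P[]/eqP->; rewrite ?Ea ?Eb ?Ec.
  by split; [split; [rewrite -Ea|rewrite -Eb]|rewrite -Ec]; apply: H;
    rewrite /= !inE eqxx ?orbT.
by move=> i; rewrite !inE => /or3P[]/eqP->; rewrite ?Ea ?Eb ?Ec.
Qed.

End RealIntegral.

(** * Measurability of vector-valued maps *)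

Section VectorMeasurability.
Context {R : realType}.

Lemma measurable_coord n (j : 'I_n) :
  measurable_fun setT ((fun x => x 0 j) : Rvec R n -> R).
Proof.
apply: (measurability _ (RGenOpens.measurableE R)) => _ [U [a [b ->]] <-].
rewrite setTI; apply: sub_sigma_algebra.
apply: (@open_comp _ _ (fun x : 'rV[R]_n => x 0 j)).
  by move=> x _; exact: coord_continuous.
exact: interval_open.
Qed.

(* An open set is a countable union of boxes with rational centre and radius. *)
Lemma measurable_rV d (T : measurableType d) n (f : T -> 'rV[R]_n) :
  (forall j, measurable_fun setT (fun t => f t 0 j)) ->
  measurable_fun setT (f : T -> Rvec R n).
Proof.
move=> mf; apply: (@measurability _ _ T (Rvec R n) setT f open erefl) => _ [U oU <-].
rewrite setTI.
pose box (q : 'rV[rat]_n * rat) :=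
  [set x : 'rV[R]_n | forall j, `|x 0 j - ratr (q.1 0 j)| < ratr q.2].
have -> : f @^-1` U =
    \bigcup_(q in [set: 'rV[rat]_n * rat])
      (if pselect (box q `<=` U) then f @^-1` box q else set0).
  apply/seteqP; split=> [t /= Uft|t [q _]]; last first.
    by case: pselect => // qU /qU.
  have /nbhs_ballP[e /= e0 eU] : nbhs (f t : 'rV[R]_n) U by exact: open_nbhs_nbhs.
  (* With a radius below [e / 2], a box containing [f t] lies in the ball of radius [e] around
     [f t]. *)
  have [r] := @rat_in_itvoo R 0 (e / 2) (divr_gt0 e0 (ltr0Sn _ 1)).
  rewrite in_itv/= => /andP[r0 re].
  have [q qP] : exists q : 'rV[rat]_n, forall j, `|f t 0 j - ratr (q 0 j)| < ratr r.
    have Hq j : exists s : rat, `|f t 0 j - ratr s| < ratr r.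
      have [|s] := @rat_in_itvoo R (f t 0 j - ratr r) (f t 0 j + ratr r); first lra.
      by rewrite in_itv/= => s01; exists s; rewrite ltr_norml; lra.
    have [q qP] := choice Hq.
    by exists (\row_j q j) => j; rewrite mxE.
  exists (q, r) => //; case: pselect => // -[] x xq /=.
  apply: eU; split=> // i j; rewrite ord1 /ball/=.
  have := qP j; have := xq j => /=; rewrite !ltr_norml; lra.
have mbox q : measurable (f @^-1` box q); last first.
  apply: countable_bigcupT_measurable => [|q]; first exact: countableP.
  by case: pselect => /= _; [exact: mbox|exact: measurable0].
have -> : f @^-1` box q = \bigcap_(j in [set: 'I_n])
    ((fun t => f t 0 j) @^-1` [set x | `|x - ratr (q.1 0 j)| < ratr q.2]).
  by apply/seteqP; split=> [t + j _|t + j]; [exact|move=> /(_ j I)].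
apply: fin_bigcap_measurable => // j _.
rewrite -[X in measurable X]setTI; apply: mf => //.
rewrite (_ : [set x | _] =
    `](ratr (q.1 0 j) - ratr q.2), (ratr (q.1 0 j) + ratr q.2)[%classic).
  exact: measurable_itv.
by apply/seteqP; split=> x /=; rewrite in_itv/= ltr_norml; lra.
Qed.

Lemma continuous_measurable_rV n p (F : 'rV[R]_n -> 'rV[R]_p) :
  continuous F -> measurable_fun setT (F : Rvec R n -> Rvec R p).
Proof.
move=> cF.
apply: (@measurability _ _ (Rvec R n) (Rvec R p) setT F open erefl) => _ [U oU <-].
rewrite setTI; apply: sub_sigma_algebra.
by apply: open_comp => // x _; exact: cF.
Qed.

End VectorMeasurability.

(** * Expectation at an independent random index *)

Section RandomIndex.
Context d (T : measurableType d) (R : realType) (P : probability T R).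
Context (K : {RV P >-> nat}) (n : nat) (p : nat -> R).
Hypothesis K_pmf : forall k, P (K @^-1` [set k]) = (p k)%:E.
Hypothesis K_support : forall k, ~~ (1 <= k <= n)%N -> p k = 0.
Notation L1 f := (P.-integrable setT (EFin \o f)).

Let KE k : measurable (K @^-1` [set k]).
Proof. by rewrite -[X in measurable X]setTI; exact: measurable_funP. Qed.

Lemma random_index_ae : {ae P, forall w, (1 <= K w <= n)%N}.
Proof.
have : P.-negligible (\bigcup_k (if (1 <= k <= n)%N then set0 else K @^-1` [set k])).
  apply: negligible_bigcup => k; case: ifPn => [_|kn]; first exact: negligible_set0.
  by exists (K @^-1` [set k]); split=> //;
    apply: etrans (K_pmf k) _; rewrite K_support.
apply: negligibleS => w /= /negP Kw; exists (K w) => //.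
by rewrite (negPf Kw).
Qed.

Context (G : set (set T)) (H : nat -> T -> R).
Hypothesis Gm : G `<=` measurable.
Hypothesis GI : setI_closed G.
Hypothesis GT : G setT.
Hypothesis K_indep : forall A k, G A ->
  (P (A `&` K @^-1` [set k]) = P A * P (K @^-1` [set k]))%E.
Hypothesis H_ge0 : forall k w, 0 <= H k w.
Hypothesis H_measurable : forall k, (1 <= k <= n)%N ->
  measurable_fun setT (H k : g_sigma_algebraType G -> R).
Hypothesis H_L1 : forall k, (1 <= k <= n)%N -> L1 (H k).

(* H k need not be measurable for k outside the support of K, so the bound
   goes through the definition of the integral as a supremum. *)
Lemma expectation_random_index :
  ('E_P[fun w => H (K w) w] <= (\sum_(k < n) p k.+1 * \int[P]_w H k.+1 w)%:E)%E.
Proof.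
(* A measurable substitute for the integrand: both agree where [1 <= K w <= n], hence almost
   everywhere. *)
pose F w := \sum_(k < n) H k.+1 w * \1_(K @^-1` [set k.+1]) w.
have kn (k : 'I_n) : (1 <= k.+1 <= n)%N by rewrite /= ltn_ord.
have IFk (k : 'I_n) : L1 (fun w => H k.+1 w * \1_(K @^-1` [set k.+1]) w).
  by apply: L1_indic => //; exact: H_L1.
have IF : L1 F by exact: L1_sum.
have F0 w : 0 <= F w by apply: sumr_ge0 => k _; rewrite mulr_ge0.
have EF : \int[P]_w F w = \sum_(k < n) p k.+1 * \int[P]_w H k.+1 w.
  rewrite Rintegral_sum//; apply: eq_bigr => k _.
  rewrite (@Rintegral_indep _ _ _ _ G)//; first by rewrite K_pmf.
  - by move=> A /K_indep.
  - exact: H_measurable.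
  - exact: H_L1.
have FK w : (1 <= K w <= n)%N -> F w = H (K w) w.
  case Kw : (K w) => [//|k] /= kn'.
  rewrite /F (bigD1 (Ordinal kn'))//= indicE mem_set//= mulr1 big1 ?addr0// => i ik.
  rewrite indicE memNset ?mulr0//= Kw => -[ki].
  by move/eqP: ik; apply; apply/val_inj.
rewrite -EF -EFin_Rintegral// unlock ge0_integralTE; last by move=> w; rewrite lee_fin.
apply: ge_ereal_sup => _ [h /= hH <-]; rewrite -integralT_nnsfun.
apply: ae_ge0_le_integral => //.
- by move=> w _; rewrite lee_fin.
- by apply/measurable_EFinP; exact: measurable_funPT.
- by move=> w _; rewrite lee_fin.
- by apply/measurable_EFinP; exact: L1_measurable IF.
- by apply: filterS random_index_ae => w Kw _; rewrite lee_fin FK// -lee_fin.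
Qed.

End RandomIndex.

(** * One step of the projected gradient method *)

Section Game.
Context {R : realType} {N : nat} {n_ : 'I_N -> nat} {m : nat}.
Notation profile := 'rV[R]_(\sum_i n_ i).
Context {X_ : forall i, set 'rV[R]_(n_ i)}.
Context {d0 : measure_display} {Om0 : measurableType d0} {Q : probability Om0 R}.
Context {xi0 : {RV Q >-> Rvec R m}} {ft : 'I_N -> profile -> 'rV[R]_m -> R}.
Hypothesis game : smooth_stochastic_game X_ xi0 ft.
Hypothesis X_nonempty : feasible X_ !=set0.
Implicit Types (x y v : profile).

Let Xcl i : closed (@X_ i) .
Proof. by have := strat_closed game; apply. Qed.
Let Xconv i : convex_set (@X_ i) .
Proof. by have := strat_convex game; apply. Qed.
Let X0 i : @X_ i !=set0.
Proof. by case: X_nonempty => x Xx; exists (submxrow x i); exact: Xx. Qed.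

Lemma is_proj_mxrow x :
  is_proj (feasible X_) x (\mxrow_i Defs.proj (@X_ i) (submxrow x i)).
Proof. by apply: is_proj_feasible => i; rewrite mxrowK; exact: projP. Qed.

Lemma proj_feasibleE x :
  Defs.proj (feasible X_) x = \mxrow_i Defs.proj (@X_ i) (submxrow x i).
Proof. by apply: is_proj_proj; [exact: feasible_convex|exact: is_proj_mxrow]. Qed.

Lemma is_proj_proj_feasible x :
  is_proj (feasible X_) x (Defs.proj (feasible X_) x).
Proof. by rewrite proj_feasibleE; exact: is_proj_mxrow. Qed.

Section Descent.
Context {P : profile -> R} {L Pmax Pmin : R}.
Hypothesis potential : smooth_potential X_ xi0 ft P L Pmax Pmin.

Lemma potential_bounds x : feasible X_ x -> Pmin <= P x <= Pmax.
Proof.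
by move=> Xx; rewrite (potential_max potential).2//= (potential_min potential).2.
Qed.

Lemma potential_descent x y : feasible X_ x -> feasible X_ y ->
  P y <= P x + dot (gradF xi0 ft x) (y - x) + L / 2 * dot (y - x) (y - x).
Proof.
move=> Xx Xy; have PL := potential_smooth potential.
have dP : differentiable P x by case: PL => -[+ _] _; apply.
have cX := feasible_convex Xconv.
rewrite -(potential_gradient Xconv (potentialP potential) Xx Xy dP) => [|i].
  exact: (@descent _ _ _ (feasible X_) _ _ _ cX PL Xx Xy).
exact: (expected_cost_differentiable game).
Qed.

Section Step.
Variable g : R.
Hypotheses (g0 : 0 < g) (gL : g <= L^-1) (L0 : 0 < L).

Let Lg1 : L * g <= 1.
Proof. by rewrite mulrC -ler_pdivlMr// div1r. Qed.

Lemma residual_proj x v :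
  Defs.proj (feasible X_) (x - g *: v) = x - g *: residual X_ g x v.
Proof.
by rewrite /residual scalerA divff ?gt_eqF// scale1r subKr.
Qed.

Lemma residual_le x v : feasible X_ x ->
  dot (residual X_ g x v) (residual X_ g x v) <= dot v (residual X_ g x v).
Proof.
move=> Xx; have := is_proj_step g0 Xx (is_proj_proj_feasible (x - g *: v)).
have -> : x - Defs.proj (feasible X_) (x - g *: v) = g *: residual X_ g x v.
  by rewrite residual_proj subKr.
by move: (residual X_ g x v) => r; rewrite !dotZr dotZl mulKf ?gt_eqF// ler_pM2l.
Qed.

Lemma residual_nonexpansive x v v' :
  enorm (residual X_ g x v - residual X_ g x v') <= enorm (v - v').
Proof.
have := is_proj_nonexpansive (is_proj_proj_feasible (x - g *: v))
  (is_proj_proj_feasible (x - g *: v')).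
rewrite !residual_proj.
have E (a b : profile) : (x - g *: a) - (x - g *: b) = - g *: (a - b).
  by rewrite opprB addrC addrA subrK scaleNr -scalerN opprB scalerBr.
by rewrite !E !enormZ ler_pM2l// normrN normr_gt0 gt_eqF.
Qed.

Lemma residual_feasible x v : feasible X_ (x - g *: residual X_ g x v).
Proof. by rewrite -residual_proj; have [] := is_proj_proj_feasible (x - g *: v). Qed.

Local Notation res := (residual X_ g).
Local Notation F := (gradF xi0 ft).

Lemma potential_step x v : feasible X_ x ->
  P (x - g *: res x v) <=
    P x - g * dot (F x) (res x v) + L / 2 * g ^+ 2 * dot (res x v) (res x v).
Proof.
move=> Xx; have := potential_descent Xx (residual_feasible x v).
move: (res x v) => r; have -> : x - g *: r - x = - (g *: r).
  by rewrite addrAC subrr add0r.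
rewrite !dotNr dotNl !dotZr dotZl; move: (dot _ r) (dot r r) => a b.
by move: (P x) (P _) => p p'; lra.
Qed.

Lemma residual_gradF_bounded x : feasible X_ x ->
  dot (res x (F x)) (res x (F x)) <= 2 * (Pmax - Pmin) / g.
Proof.
move=> Xx; have := potential_step (F x) Xx; have := residual_le (F x) Xx.
have /andP[_ b1] := potential_bounds Xx.
have /andP[b2 _] := potential_bounds (residual_feasible x (F x)).
set r := res x (F x) in b2 * => H1 H2.
rewrite ler_pdivlMr//.
have H3 : L * g * (g * dot r r) <= 1 * (g * dot r r).
  by rewrite ler_wpM2r// mulr_ge0 ?dot_ge0// ltW.
have H4 : g * dot r r <= g * dot (F x) r by rewrite ler_pM2l.
by move: H2 H3; rewrite expr2 mul1r => H2 H3; lra.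
Qed.

Lemma potential_residual_step x v : feasible X_ x ->
  (g - L / 2 * g ^+ 2) * dot (res x v) (res x v) <=
    P x - P (x - g *: res x v) + g * dot (v - F x) (res x (F x))
    + g * dot (v - F x) (v - F x).
Proof.
move=> Xx; have := potential_step v Xx; have := residual_le v Xx.
have := residual_nonexpansive x v (F x).
move: (res x v) (res x (F x)) => r r' H0 H1 H2.
(* The error is moved from the sampled residual [r] to the exact residual [r']; nonexpansiveness
   limits the cost of the exchange to the squared error. *)
have : dot (v - F x) (r - r') <= dot (v - F x) (v - F x).
  rewrite (le_trans (cauchy_schwarz _ _))// -enorm_sqr expr2.
  by rewrite ler_wpM2l ?enorm_ge0.
rewrite dotBr => H3; have Hv : dot v r = dot (v - F x) r + dot (F x) r.
  by rewrite -dotDl subrK.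
move: H1 H2 H3 Hv; clear H0.
move: (dot _ (v - _)) (dot r r) (dot v r) (dot (F x) r) (dot (v - _) r) (dot _ r').
move: (P x) (P _) (L / 2 * g ^+ 2) => p p' c ee rr vr Fr er er' H1 H2 H3 Hv.
have : rr - Fr <= er' + ee by lra.
by rewrite -(ler_pM2l g0) => ?; lra.
Qed.

Lemma residual_gradF_le x v :
  dot (res x (F x)) (res x (F x)) <=
    2 * dot (res x v) (res x v) + 2 * dot (v - F x) (v - F x).
Proof.
by apply: dot_le_double; rewrite -enorm_le; exact: residual_nonexpansive.
Qed.

End Step.
End Descent.

(** * Measurability of gradients, steps and residuals *)

Lemma strategy_measurable i : measurable (@X_ i : set (Rvec R (n_ i))).
Proof.
rewrite -[X in measurable X]setCK; apply: measurableC.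
by apply: sub_sigma_algebra; exact: (closed_openC (@Xcl i)).
Qed.

Lemma submxrow_measurable i :
  measurable_fun setT ((fun x : profile => submxrow x i)
    : Rvec R (\sum_i n_ i) -> Rvec R (n_ i)).
Proof.
apply: measurable_rV => j.
have -> : (fun x : profile => submxrow x i 0 j) = (fun x => x 0 (tagnat.Rank i j)).
  by apply/funext => x; rewrite mxE.
exact: measurable_coord.
Qed.

Lemma feasible_measurable : measurable (feasible X_ : set (Rvec R (\sum_i n_ i))).
Proof.
have -> : feasible X_ = \bigcap_(i in [set: 'I_N])
    ((fun x : profile => submxrow x i) @^-1` (@X_ i)).
  by apply/seteqP; split=> [x + i _|x + i]; [exact|move=> /(_ i I)].
apply: fin_bigcap_measurable => // i _; rewrite -[X in measurable X]setTI.
by apply: submxrow_measurable => //; exact: strategy_measurable.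
Qed.

Section Measurability.
Context {d : measure_display} {T : measurableType d}.

Lemma mxrow_measurable (u : forall i, T -> 'rV[R]_(n_ i)) :
  (forall i j, measurable_fun setT (fun t => u i t 0 j)) ->
  measurable_fun setT ((fun t => \mxrow_i u i t) : T -> Rvec R (\sum_i n_ i)).
Proof.
by move=> mu; apply: measurable_rV => j; under eq_fun do rewrite mxE; exact: mu.
Qed.

Lemma coord_measurable n (f : T -> Rvec R n) j : measurable_fun setT f ->
  measurable_fun setT (fun t => (f t : 'rV[R]_n) 0 j).
Proof. by move=> mf; exact: (measurableT_comp (measurable_coord j) mf). Qed.

Lemma proj_measurable i (u : T -> Rvec R (n_ i)) : measurable_fun setT u ->
  measurable_fun setT ((fun t => Defs.proj (@X_ i) (u t)) : T -> Rvec R (n_ i)).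
Proof.
move=> mu; apply: (measurableT_comp _ mu).
by apply: continuous_measurable_rV; exact: proj_continuous.
Qed.

Lemma dot_measurable n (u v : T -> 'rV[R]_n) :
  (forall j, measurable_fun setT (fun t => u t 0 j)) ->
  (forall j, measurable_fun setT (fun t => v t 0 j)) ->
  measurable_fun setT (fun t => dot (u t) (v t)).
Proof.
by move=> mu mv; apply: measurable_sum => j; exact: measurable_funM.
Qed.

Lemma pgrad_measurable (x : T -> profile) (z : T -> Rvec R m) i j :
  measurable_fun setT (x : T -> Rvec R _) -> measurable_fun setT z ->
  (forall t, feasible X_ (x t)) ->
  measurable_fun setT (fun t => pgrad (fun y => ft i y (z t)) i (x t) 0 j).
Proof.
move=> mx mz Xx.
pose F := [set p : Rvec R (\sum_i n_ i) * Rvec R m | feasible X_ p.1].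
apply: (@measurable_comp _ _ _ _ _ _ F
  (fun p : Rvec R (\sum_i n_ i) * Rvec R m => pgrad (fun y => ft i y p.2) i p.1 0 j)
  setT (fun t => (x t : Rvec R _, z t))).
- rewrite (_ : F = fst @^-1` (feasible X_ : set (Rvec R _)))//.
  rewrite -[X in measurable X]setTI; apply: measurable_fst => //.
  exact: feasible_measurable.
- by move=> _ [t _ <-]; exact: Xx.
- exact: (sample_grad_measurable game).
- exact: measurable_fun_pair.
Qed.

Lemma batch_grad_measurable (s : nat) (x : T -> profile) (z : 'I_s -> T -> Rvec R m) i j :
  measurable_fun setT (x : T -> Rvec R _) ->
  (forall l, measurable_fun setT (z l)) -> (forall t, feasible X_ (x t)) ->
  measurable_fun setT (fun t => batch_grad ft i (x t) (fun l => z l t) 0 j).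
Proof.
move=> mx mz Xx; under eq_fun do rewrite mxE summxE.
apply: measurable_funM => //; apply: measurable_sum => l.
exact: pgrad_measurable.
Qed.

Lemma step_measurable (x : T -> profile) (v : T -> profile) (g : R) :
  measurable_fun setT (x : T -> Rvec R _) ->
  measurable_fun setT (v : T -> Rvec R _) ->
  measurable_fun setT ((fun t => \mxrow_i Defs.proj (@X_ i)
    (submxrow (x t) i - g *: submxrow (v t) i)) : T -> Rvec R _).
Proof.
move=> mx mv; apply: mxrow_measurable => i j; apply: coord_measurable.
apply: proj_measurable; apply: measurable_rV => k.
under eq_fun do rewrite !mxE.
apply: measurable_funB; first exact: coord_measurable.
by apply: measurable_funM => //; exact: coord_measurable.
Qed.

Lemma residual_measurable (x v : T -> profile) (g : R) j :
  measurable_fun setT (x : T -> Rvec R _) ->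
  measurable_fun setT (v : T -> Rvec R _) ->
  measurable_fun setT (fun t => residual X_ g (x t) (v t) 0 j).
Proof.
move=> mx mv; under eq_fun do rewrite mxE mxE [X in _ * (_ + X)]mxE proj_feasibleE.
apply: measurable_funM => //; apply: measurable_funB; first exact: coord_measurable.
apply: coord_measurable.
have -> : (fun t => \mxrow_i Defs.proj (@X_ i) (submxrow (x t - g *: v t) i)) =
    (fun t => \mxrow_i Defs.proj (@X_ i) (submxrow (x t) i - g *: submxrow (v t) i)).
  by apply/funext => t; apply: eq_mxrow => i; rewrite submxrowB submxrowZ.
exact: step_measurable.
Qed.

End Measurability.
End Game.

(** * The stochastic scheme *)

Section Scheme.
Context {R : realType} {N : nat} {n_ : 'I_N -> nat} {m : nat}.
Notation profile := 'rV[R]_(\sum_i n_ i).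
Context {X_ : forall i, set 'rV[R]_(n_ i)}.
Context {d0 : measure_display} {Om0 : measurableType d0} {Q : probability Om0 R}.
Context {xi0 : {RV Q >-> Rvec R m}} {ft : 'I_N -> profile -> 'rV[R]_m -> R}.
Hypothesis game : smooth_stochastic_game X_ xi0 ft.
Context {d : measure_display} {Om : measurableType d} {Pr : probability Om R}.
Context {x0 : profile} {gamma : nat -> R} {S : nat -> nat}.
Context {xi : forall k : nat, 'I_N -> 'I_(S k) -> {RV Pr >-> Rvec R m}}.
Hypothesis Xx0 : feasible X_ x0.
Hypothesis gamma0 : forall k, 0 < gamma k.

Notation L1 f := (Pr.-integrable setT (EFin \o f)).
Notation xk := (iterate X_ ft x0 gamma xi).
Notation noisy k w :=
  (batch_gradF ft (xk k w) (fun (i : 'I_N) (l : 'I_(S k)) => @xi k i l w)).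
Notation Gtk := (Gt X_ ft x0 gamma xi).
Notation Gk := (G X_ xi0 ft x0 gamma xi).

Let X0 : feasible X_ !=set0. Proof. by exists x0. Qed.

Lemma iterateS k w : xk k.+1 w = xk k w - gamma k *: Gtk k w.
Proof.
rewrite -(residual_proj (gamma0 k)) (proj_feasibleE game X0) /=.
apply: eq_mxrow => i; congr (Defs.proj _ _).
by rewrite submxrowB submxrowZ mxrowK.
Qed.

Lemma iterate_feasible k w : feasible X_ (xk k w).
Proof.
case: k => [//|k]; rewrite iterateS.
exact: (residual_feasible game X0 (gamma0 k)).
Qed.

(* sigma_samples xi K is, by conversion, <<s sample_events K>>. *)
Definition sample_events (K : set nat) : set (set Om) :=
  [set A | exists j i l, K j /\ g_sigma_algebra_preimage (@xi j i l) A].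

Lemma sample_events_measurable K : sample_events K `<=` measurable.
Proof. by move=> _ [j [i [l [_ [B mB <-]]]]]; exact: measurable_funP. Qed.

Lemma sample_measurable K j i l : K j ->
  measurable_fun setT (@xi j i l : g_sigma_algebraType (sample_events K) -> Rvec R m).
Proof.
move=> Kj _ B mB; apply: sub_sigma_algebra.
by exists j, i, l; split=> //; exists B.
Qed.

Section SubSigmaAlgebra.
Variable H : set (set Om).
Notation TH := (g_sigma_algebraType H).

(** The generator [H] is kept arbitrary, since measurability is needed for several sigma-algebras:
    those of the past samples and of all samples and, for the exact residual, that of the
    iterate. *)
Lemma noisy_measurable k :
  measurable_fun setT (xk k : TH -> Rvec R _) ->
  (forall i l, measurable_fun setT (@xi k i l : TH -> Rvec R m)) ->
  measurable_fun setT ((fun w => noisy k w) : TH -> Rvec R _).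
Proof.
move=> mx mz; apply: mxrow_measurable => i j.
apply: (batch_grad_measurable game (T := TH)
  (z := fun l => (@xi k i l : TH -> Rvec R m))) => // w.
exact: iterate_feasible.
Qed.

Lemma iterate_measurable k :
  (forall j i l, (j < k)%N ->
    measurable_fun setT (@xi j i l : TH -> Rvec R m)) ->
  measurable_fun setT (xk k : TH -> Rvec R _).
Proof.
elim: k => [|k IH] mz; first exact: measurable_cst.
have mx : measurable_fun setT (xk k : TH -> Rvec R _).
  by apply: IH => j i l jk; apply: mz; exact: ltnW.
have -> : xk k.+1 = (fun w => \mxrow_i Defs.proj (@X_ i)
    (submxrow (xk k w) i - gamma k *: submxrow (noisy k w) i)).
  by apply/funext => w /=; apply: eq_mxrow => i; rewrite mxrowK.
apply: (step_measurable game X0 (T := TH)) => //.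
by apply: noisy_measurable => // i l; exact: mz.
Qed.

Lemma Gt_measurable k j :
  measurable_fun setT (xk k : TH -> Rvec R _) ->
  (forall i l, measurable_fun setT (@xi k i l : TH -> Rvec R m)) ->
  measurable_fun setT ((fun w => Gtk k w 0 j) : TH -> R).
Proof.
move=> mx mz; apply: (residual_measurable game X0 (T := TH)) => //.
exact: noisy_measurable.
Qed.

Lemma G_measurable k j :
  measurable_fun setT (xk k : TH -> Rvec R _) ->
  (forall i j, measurable_fun setT
    ((fun w => pgrad (expected_cost xi0 ft i) i (xk k w) 0 j) : TH -> R)) ->
  measurable_fun setT ((fun w => Gk k w 0 j) : TH -> R).
Proof.
move=> mx mY; apply: (residual_measurable game X0 (T := TH)) => //.
exact: mxrow_measurable.
Qed.

End SubSigmaAlgebra.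

Lemma iterate_measurable_samples k (K : set nat) :
  (forall j, (j < k)%N -> K j) ->
  measurable_fun setT (xk k : g_sigma_algebraType (sample_events K) -> Rvec R _).
Proof. by move=> kK; apply: iterate_measurable => j i l /kK; exact: sample_measurable. Qed.

(** * One iteration: moments of the batch error *)

Section Iteration.
Variable k : nat.
Hypothesis S_gt0 : (0 < S k)%N.
Notation SX := (sigma_iterate X_ ft x0 gamma xi k).
Notation Sxi i l := (g_sigma_algebra_preimage (@xi k i l)).

Lemma iterate_measurable_sigma :
  measurable_fun setT (xk k : g_sigma_algebraType SX -> Rvec R _).
Proof. by move=> _ B mB; apply: sub_sigma_algebra; exists B. Qed.

(** The iterate is a function of the earlier samples, so the independence of fresh samples from the
    history extends to it. *)
Lemma sigma_iterate_samples A :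
  SX A -> sigma_samples xi [set j | (j < k)%N] A.
Proof.
move=> [B mB <-].
by apply: (@iterate_measurable_samples k [set j | (j < k)%N]).
Qed.

Lemma sigma_iterate_measurable : SX `<=` measurable.
Proof.
move=> A /sigma_iterate_samples; apply: g_sigma_algebra_measurable.
exact: sample_events_measurable.
Qed.

Lemma g_sigma_algebra_preimage_setI d' (T' : measurableType d') (f : Om -> T') :
  setI_closed (g_sigma_algebra_preimage f).
Proof.
move=> _ _ [A mA <-] [B mB <-]; exists (A `&` B); first exact: measurableI.
by rewrite !setTI preimage_setI.
Qed.

Lemma g_sigma_algebra_preimageT d' (T' : measurableType d') (f : Om -> T') :
  g_sigma_algebra_preimage f setT.
Proof. by exists setT => //; rewrite preimage_setT setTI. Qed.

(** A pi-system generating the joint sigma-algebra of the iterate and the sample [l]; on it,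
    independence from a further sample is a product formula for three events. *)
Definition rectangles i l : set (set Om) :=
  [set E | exists A B, [/\ SX A, Sxi i l B & E = A `&` B]].

Lemma rectanglesT i l : rectangles i l setT.
Proof. by exists setT, setT; split; rewrite ?setTI//; exact: g_sigma_algebra_preimageT. Qed.

Lemma rectangles_setI i l : setI_closed (rectangles i l).
Proof.
move=> _ _ [A [B [SA SB ->]]] [A' [B' [SA' SB' ->]]].
exists (A `&` A'), (B `&` B'); split.
- exact: (g_sigma_algebra_preimage_setI SA SA').
- exact: (g_sigma_algebra_preimage_setI SB SB').
- exact: setIACA.
Qed.

Lemma sample_event_measurable i l : Sxi i l `<=` measurable.
Proof. by move=> _ [B mB <-]; exact: measurable_funP. Qed.

Lemma rectangles_measurable i l : rectangles i l `<=` measurable.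
Proof.
move=> _ [A [B [/sigma_iterate_measurable mA /sample_event_measurable mB ->]]].
exact: measurableI.
Qed.

Lemma sigma_iterate_rectangles i l A : SX A -> <<s rectangles i l >> A.
Proof.
move=> SA; apply: sub_sigma_algebra; exists A, setT.
by split; rewrite ?setIT//; exact: g_sigma_algebra_preimageT.
Qed.

Lemma sample_measurable_rectangles i l :
  measurable_fun setT (@xi k i l : g_sigma_algebraType (rectangles i l) -> Rvec R m).
Proof.
move=> _ B mB; apply: sub_sigma_algebra; exists setT, (@xi k i l @^-1` B).
by split=> //; [exact: g_sigma_algebra_preimageT|exists B; rewrite ?setTI].
Qed.

Lemma iterate_measurable_rectangles i l :
  measurable_fun setT (xk k : g_sigma_algebraType (rectangles i l) -> Rvec R _).
Proof.
apply: g_sigma_measurable_funS iterate_measurable_sigma.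
exact: sigma_iterate_rectangles.
Qed.

Section Independence.
Hypothesis fresh : forall i,
  mutually_independent Pr (fun o : option 'I_(S k) =>
    if o is Some l then g_sigma_algebra_preimage (@xi k i l)
    else sigma_samples xi [set j | (j < k)%N]).

Lemma sample_independent i l l' A B C : l != l' ->
  SX A -> Sxi i l B -> Sxi i l' C ->
  (Pr (A `&` B `&` C) = Pr (A `&` B) * Pr C)%E.
Proof.
move=> ll' /sigma_iterate_samples SA SB SC.
rewrite (mutually_independent3 (@fresh i) (a := None) (b := Some l) (c := Some l'))//.
by rewrite (mutually_independent2 (@fresh i) (a := None) (b := Some l)).
Qed.

Notation Y i j w := (pgrad (expected_cost xi0 ft i) i (xk k w) 0 j).
Notation Z i l j w := (pgrad (fun y => ft i y (@xi k i l w)) i (xk k w) 0 j).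

Hypothesis unbiased : forall i l j,
  is_cond_exp Pr SX (fun w => Z i l j w) (fun w => Y i j w).

Definition noise i l j w : R := Z i l j w - Y i j w.
Arguments noise : clear implicits.

Lemma noise_L1 i l j : L1 (noise i l j).
Proof. exact: is_cond_exp_L1 (unbiased l j). Qed.

(** Unbiasedness makes the exact gradient a version of a conditional expectation given the iterate,
    and that includes measurability. Since the batch is nonempty, its sample 0 can serve as the
    witness. *)
Lemma pgrad_measurable_sigma i j :
  measurable_fun setT ((fun w => Y i j w) : g_sigma_algebraType SX -> R).
Proof.
have [_ _ mY _] := unbiased (Ordinal S_gt0) j.
by move=> _ B mB; apply: sub_sigma_algebra; rewrite setTI; exact: mY.
Qed.

Lemma noise_measurable i l j :
  measurable_fun setT (noise i l j : g_sigma_algebraType (rectangles i l) -> R).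
Proof.
apply: measurable_funB.
  apply: (pgrad_measurable game (T := g_sigma_algebraType (rectangles i l))
    (z := (@xi k i l : g_sigma_algebraType (rectangles i l) -> Rvec R m))).
  - exact: iterate_measurable_rectangles.
  - exact: sample_measurable_rectangles.
  - exact: iterate_feasible.
apply: g_sigma_measurable_funS (pgrad_measurable_sigma j).
exact: sigma_iterate_rectangles.
Qed.

Lemma noise_orthogonal i l j A : SX A -> \int[Pr]_w (noise i l j w * \1_A w) = 0.
Proof.
move=> SA; apply: (is_cond_exp_orthogonal (unbiased l j)) => //.
exact: sigma_iterate_measurable.
Qed.

Lemma noise_orthogonal_sigma i l j : orthogonal_to Pr SX (noise i l j).
Proof.
apply: orthogonal_to_pi.
- exact: noise_L1.
- exact: sigma_iterate_measurable.
- exact: g_sigma_algebra_preimage_setI.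
- exact: g_sigma_algebra_preimageT.
- exact: noise_orthogonal.
Qed.

(* Given x^k, the samples l and l' are independent: on a rectangle A `&` B the
   factor B splits off, and A contributes 0 by unbiasedness. *)
Lemma noise_orthogonal_rectangles i l l' j : l != l' ->
  orthogonal_to Pr (rectangles i l) (noise i l' j).
Proof.
move=> ll'; apply: orthogonal_to_pi.
- exact: noise_L1.
- exact: rectangles_measurable.
- exact: rectangles_setI.
- exact: rectanglesT.
move=> _ [A [B [SA SB ->]]].
have mA := sigma_iterate_measurable SA; have mB := sample_event_measurable SB.
have E w : noise i l' j w * \1_(A `&` B) w = noise i l' j w * \1_A w * \1_B w.
  by rewrite indicI mulrA.
under eq_Rintegral do rewrite E.
rewrite (@Rintegral_indep _ _ _ _ (rectangles i l') B)//.
- by rewrite noise_orthogonal// mulr0.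
- exact: rectangles_measurable.
- exact: rectangles_setI.
- exact: rectanglesT.
- move=> _ [A' [C [SA' SC ->]]].
  by apply: sample_independent SA' SC SB; rewrite eq_sym.
- apply: measurable_funM; first exact: noise_measurable.
  by apply: measurable_indic; exact: sigma_iterate_rectangles.
- by apply: L1_indic => //; exact: noise_L1.
Qed.

Variable sigma : R.
Hypothesis variance : forall i l, exists V : Om -> R,
  is_cond_exp Pr SX
    (fun w => enorm (pgrad (fun y => ft i y (@xi k i l w)) i (xk k w)
                     - pgrad (expected_cost xi0 ft i) i (xk k w)) ^+ 2) V /\
  {ae Pr, forall w, V w <= sigma ^+ 2}.

Lemma enorm_noise i (l : 'I_(S k)) w :
  enorm (pgrad (fun y => ft i y (@xi k i l w)) i (xk k w)
         - pgrad (expected_cost xi0 ft i) i (xk k w)) ^+ 2 =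
  \sum_j noise i l j w * noise i l j w.
Proof. by rewrite enorm_sqr; apply: eq_bigr => j _; rewrite coordB. Qed.

Lemma noise_measurableT i l j : measurable_fun setT (noise i l j).
Proof. exact: L1_measurable (noise_L1 l j). Qed.

(** The variance condition contains the integrability of the squared norm of the error, which
    dominates the square of each coordinate. *)
Lemma noise_sqr_L1 i l j : L1 (fun w => noise i l j w * noise i l j w).
Proof.
have [V [[IV _ _ _] _]] := variance i l.
apply: (L1_le _ _ IV).
  exact: measurable_funM (noise_measurableT _ _) (noise_measurableT _ _).
move=> w; rewrite enorm_noise ger0_norm -?expr2 ?sqr_ge0// (bigD1 j)//= expr2 lerDl.
by apply: sumr_ge0 => j' _; rewrite -expr2 sqr_ge0.
Qed.

Lemma noise_variance i l :
  \sum_j \int[Pr]_w (noise i l j w * noise i l j w) <= sigma ^+ 2.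
Proof.
rewrite -Rintegral_sum => [|j]; last exact: noise_sqr_L1.
have [V [[IZ IV _ /(_ setT) ZV] Vs]] := variance i l.
under eq_Rintegral do rewrite -enorm_noise.
(* Testing the conditional expectation on the sure event shows that the squared error and [V] have
   the same mean. *)
rewrite /Rintegral ZV; last exact: g_sigma_algebra_preimageT.
by apply: ae_Rintegral_le => //; exact: sqr_ge0.
Qed.

Lemma noise_mul_L1 i l l' j : L1 (fun w => noise i l j w * noise i l' j w).
Proof.
apply: (L1_le _ _ (L1D (noise_sqr_L1 l j) (noise_sqr_L1 l' j))).
  exact: measurable_funM (noise_measurableT _ _) (noise_measurableT _ _).
move=> w; move: (noise i l j w) (noise i l' j w) => a b.
by rewrite ler_norml; apply/andP; split; nra.
Qed.

(** The error of sample [l] is measurable for the rectangles of [l], and the error of [l'] is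
    orthogonal to these. *)
Lemma noise_cross i l l' j : l != l' ->
  \int[Pr]_w (noise i l j w * noise i l' j w) = 0.
Proof.
move=> ll'; under eq_Rintegral do rewrite mulrC.
apply: (@orthogonal_toM _ _ _ _ (rectangles i l)).
- exact: rectangles_measurable.
- exact: noise_L1.
- exact: noise_orthogonal_rectangles.
- exact: noise_measurable.
- exact: noise_mul_L1.
Qed.

Definition batch_noise w : profile := noisy k w - gradF xi0 ft (xk k w).

Lemma submxrow_batch_noise i j w :
  submxrow (batch_noise w) i 0 j = (S k)%:R^-1 * \sum_l noise i l j w.
Proof.
have -> : \sum_l noise i l j w = (\sum_l Z i l j w) - Y i j w *+ S k.
  by rewrite sumrB sumr_const card_ord.
rewrite submxrowB !mxrowK coordB /batch_grad mxE summxE mulrBr; congr (_ - _).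
by rewrite -[X in _ = _ * X]mulr_natl mulKf// pnatr_eq0 -lt0n.
Qed.

Lemma dot_batch_noise w : dot (batch_noise w) (batch_noise w) =
  \sum_i \sum_j (S k)%:R^-1 ^+ 2
    * \sum_l \sum_l' noise i l j w * noise i l' j w.
Proof.
rewrite dot_block; apply: eq_bigr => i _; apply: eq_bigr => j _.
rewrite submxrow_batch_noise mulrACA -expr2; congr (_ * _).
by rewrite mulr_suml; apply: eq_bigr => l _; rewrite mulr_sumr.
Qed.

Lemma batch_noise_L1 : L1 (fun w => dot (batch_noise w) (batch_noise w)).
Proof.
under [X in EFin \o X]eq_fun do rewrite dot_batch_noise.
apply: L1_sum => i; apply: L1_sum => j; apply: L1Z.
by apply: L1_sum => l; apply: L1_sum => l'; exact: noise_mul_L1.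
Qed.

(** The squared norm splits over players and coordinates, so all cross terms are between samples of
    one player's batch and vanish in the mean. The [S k] diagonal terms against the factor
    [(S k)^-2] leave [sigma^2 / S k] per player. *)
Lemma batch_noise_variance :
  \int[Pr]_w dot (batch_noise w) (batch_noise w) <= sigma ^+ 2 * N%:R / (S k)%:R.
Proof.
under eq_Rintegral do rewrite dot_batch_noise.
have I3 i j l : L1 (fun w => \sum_l' noise i l j w * noise i l' j w).
  by apply: L1_sum => l'; exact: noise_mul_L1.
have I2 i j : L1 (fun w => \sum_l \sum_l' noise i l j w * noise i l' j w).
  by apply: L1_sum => l; exact: I3.
have I1 i : L1 (fun w => \sum_j (S k)%:R^-1 ^+ 2
    * \sum_l \sum_l' noise i l j w * noise i l' j w).
  by apply: L1_sum => j; exact: L1Z.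
rewrite Rintegral_sum//.
apply: (@le_trans _ _ (\sum_(i < N) sigma ^+ 2 / (S k)%:R)); last first.
  rewrite sumr_const card_ord -[leLHS]mulr_natl.
  by rewrite mulrA [N%:R * _]mulrC.
apply: ler_sum => i _; rewrite Rintegral_sum => [|j]; last exact: L1Z.
have E j : \int[Pr]_w ((S k)%:R^-1 ^+ 2
      * \sum_l \sum_l' noise i l j w * noise i l' j w) =
    (S k)%:R^-1 ^+ 2 * \sum_l \int[Pr]_w (noise i l j w * noise i l j w).
  rewrite RintegralZl// Rintegral_sum//; congr (_ * _); apply: eq_bigr => l _.
  rewrite Rintegral_sum => [|l']; last exact: noise_mul_L1.
  rewrite (bigD1 l)//= big1 ?addr0// => l' ll'.
  by rewrite noise_cross// eq_sym.
under eq_bigr do rewrite E.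
rewrite -mulr_sumr exchange_big/= expr2 -mulrA [leRHS]mulrC.
rewrite ler_wpM2l ?invr_ge0 ?ler0n// ler_pdivrMl ?ltr0n//.
apply: (@le_trans _ _ (\sum_(l < S k) sigma ^+ 2)).
  by apply: ler_sum => l _; exact: noise_variance.
by rewrite sumr_const card_ord mulr_natl.
Qed.

Section GradientMap.
Context {P : profile -> R} {L Pmax Pmin : R}.
Hypothesis potential : smooth_potential X_ xi0 ft P L Pmax Pmin.
Hypotheses (gammaL : gamma k <= L^-1) (L0 : 0 < L).

Lemma G_bounded w : dot (Gk k w) (Gk k w) <= 2 * (Pmax - Pmin) / gamma k.
Proof.
exact: (residual_gradF_bounded game X0 potential (gamma0 k) gammaL L0
  (iterate_feasible k w)).
Qed.

Lemma G_measurable_sigma j :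
  measurable_fun setT ((fun w => Gk k w 0 j) : g_sigma_algebraType SX -> R).
Proof.
apply: G_measurable; first exact: iterate_measurable_sigma.
exact: pgrad_measurable_sigma.
Qed.

Lemma G_sqr_measurable_sigma :
  measurable_fun setT
    ((fun w => dot (Gk k w) (Gk k w)) : g_sigma_algebraType SX -> R).
Proof. by apply: dot_measurable => j; exact: G_measurable_sigma. Qed.

Lemma G_sqr_L1 : L1 (fun w => dot (Gk k w) (Gk k w)).
Proof.
apply: L1_bounded => [|w]; last by rewrite ger0_norm ?dot_ge0//; exact: G_bounded.
exact: g_sigma_measurable_fun sigma_iterate_measurable G_sqr_measurable_sigma.
Qed.

Lemma dot_batch_noise_G w : dot (batch_noise w) (Gk k w) =
  \sum_i \sum_j (S k)%:R^-1
    * \sum_l noise i l j w * submxrow (Gk k w) i 0 j.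
Proof.
rewrite dot_block; apply: eq_bigr => i _; apply: eq_bigr => j _.
by rewrite submxrow_batch_noise -mulrA mulr_suml.
Qed.

Lemma G_block_measurable_sigma i j :
  measurable_fun setT ((fun w => submxrow (Gk k w) i 0 j) : g_sigma_algebraType SX -> R).
Proof.
have -> : (fun w => submxrow (Gk k w) i 0 j) = (fun w => Gk k w 0 (tagnat.Rank i j)).
  by apply/funext => w; rewrite mxE.
exact: G_measurable_sigma.
Qed.

(** An integrable error times a bounded factor: each coordinate of G is at most its Euclidean norm,
    controlled by [G_bounded]. *)
Lemma noise_G_L1 i l j : L1 (fun w => noise i l j w * submxrow (Gk k w) i 0 j).
Proof.
apply: (@L1M_bounded _ _ _ _ _ _ (Num.sqrt (2 * (Pmax - Pmin) / gamma k))).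
- exact: noise_L1.
- apply: (g_sigma_measurable_fun sigma_iterate_measurable).
  exact: G_block_measurable_sigma.
move=> w; rewrite mxE (le_trans (coord_le_enorm _ _))//.
rewrite -[leLHS]ger0_norm ?enorm_ge0// -sqrtr_sqr enorm_sqr ler_wsqrtr//.
exact: G_bounded.
Qed.

Lemma noise_G_eq0 i l j :
  \int[Pr]_w (noise i l j w * submxrow (Gk k w) i 0 j) = 0.
Proof.
apply: (@orthogonal_toM _ _ _ _ SX).
- exact: sigma_iterate_measurable.
- exact: noise_L1.
- exact: noise_orthogonal_sigma.
- exact: G_block_measurable_sigma.
- exact: noise_G_L1.
Qed.

Lemma batch_noise_G_L1 : L1 (fun w => dot (batch_noise w) (Gk k w)).
Proof.
under [X in EFin \o X]eq_fun do rewrite dot_batch_noise_G.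
apply: L1_sum => i; apply: L1_sum => j; apply: L1Z; apply: L1_sum => l.
exact: noise_G_L1.
Qed.

Lemma batch_noise_G_eq0 : \int[Pr]_w dot (batch_noise w) (Gk k w) = 0.
Proof.
under eq_Rintegral do rewrite dot_batch_noise_G.
have I2 i j : L1 (fun w => \sum_l noise i l j w * submxrow (Gk k w) i 0 j).
  by apply: L1_sum => l; exact: noise_G_L1.
have I1 i : L1 (fun w => \sum_j (S k)%:R^-1
    * \sum_l noise i l j w * submxrow (Gk k w) i 0 j).
  by apply: L1_sum => j; exact: L1Z.
rewrite Rintegral_sum// big1// => i _.
rewrite Rintegral_sum => [|j]; last exact: L1Z.
rewrite big1// => j _; rewrite RintegralZl// Rintegral_sum => [|l]; last exact: noise_G_L1.
by rewrite big1 ?mulr0// => l _; exact: noise_G_eq0.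
Qed.

Lemma iterate_potential_step w :
  (gamma k - L / 2 * gamma k ^+ 2) * dot (Gtk k w) (Gtk k w) <=
    P (xk k w) - P (xk k.+1 w) + gamma k * dot (batch_noise w) (Gk k w)
    + gamma k * dot (batch_noise w) (batch_noise w).
Proof.
rewrite iterateS; exact: (potential_residual_step game X0 potential (gamma0 k) _
  (iterate_feasible k w)).
Qed.

Lemma Gt_sqr_measurable (K : set nat) : (forall j, (j <= k)%N -> K j) ->
  measurable_fun setT ((fun w => dot (Gtk k w) (Gtk k w))
    : g_sigma_algebraType (sample_events K) -> R).
Proof.
move=> kK; apply: dot_measurable => j; apply: Gt_measurable.
- by apply: iterate_measurable_samples => j' /ltnW; exact: kK.
- by move=> i l; apply: sample_measurable; exact: kK.
- by apply: iterate_measurable_samples => j' /ltnW; exact: kK.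
- by move=> i l; apply: sample_measurable; exact: kK.
Qed.

(** The one-step inequality supplies the dominating function [h]: the difference of potentials is at
    most [Pmax - Pmin] and the error terms are integrable. Its coefficient [c] stays positive even
    for [gamma k = 1/L], where [gamma k - L gamma k ^2] vanishes. *)
Lemma Gt_sqr_L1 : L1 (fun w => dot (Gtk k w) (Gtk k w)).
Proof.
pose c := gamma k - L / 2 * gamma k ^+ 2.
have c0 : 0 < c.
  have : L * gamma k <= 1 by rewrite mulrC -ler_pdivlMr// div1r.
  by rewrite -(ler_pM2r (gamma0 k)) /c expr2 => ?; have := gamma0 k; lra.
pose h w := c^-1 * (Pmax - Pmin + gamma k * `|dot (batch_noise w) (Gk k w)|
    + gamma k * dot (batch_noise w) (batch_noise w)).
have Ih : L1 h.
  apply: L1Z; apply: L1D; last by apply: L1Z; exact: batch_noise_L1.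
  apply: L1D; first exact: L1_cst.
  by apply: L1Z; apply: integrable_norm => //; exact: batch_noise_G_L1.
apply: (L1_le _ _ Ih).
  apply: g_sigma_measurable_fun (@Gt_sqr_measurable setT _) => //.
  exact: sample_events_measurable.
move=> w; rewrite ger0_norm ?dot_ge0// /h ler_pdivlMl//.
rewrite (le_trans (iterate_potential_step w))// lerD2r.
have /andP[_ b1] := potential_bounds potential (iterate_feasible k w).
have /andP[b2 _] := potential_bounds potential (iterate_feasible k.+1 w).
apply: lerD; first lra.
by rewrite ler_pM2l// ler_norm.
Qed.

Lemma G_sqr_le w : dot (Gk k w) (Gk k w) <=
  2 * dot (Gtk k w) (Gtk k w) + 2 * dot (batch_noise w) (batch_noise w).
Proof. exact: (residual_gradF_le game X0). Qed.

Lemma G_sqr_expectation_le :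
  \int[Pr]_w dot (Gk k w) (Gk k w) <=
    2 * \int[Pr]_w dot (Gtk k w) (Gtk k w) + 2 * (sigma ^+ 2 * N%:R / (S k)%:R).
Proof.
have I1 := L1Z 2 Gt_sqr_L1; have I2 := L1Z 2 batch_noise_L1.
apply: (le_trans (le_Rintegral _ G_sqr_L1 (L1D I1 I2) _)) => //.
  by move=> w _; exact: G_sqr_le.
rewrite (RintegralD _ I1 I2)// (RintegralZl _ _ Gt_sqr_L1)//.
rewrite (RintegralZl _ _ batch_noise_L1)//.
by rewrite lerD2l ler_pM2l// batch_noise_variance.
Qed.

End GradientMap.
End Independence.
End Iteration.

(** * Summation over the run and the random output *)

Section Run.
Variables (T : nat) (sigma : R).
Hypothesis S_gt0 : forall k, (0 < S k)%N.
Hypothesis fresh : forall k i,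
  mutually_independent Pr (fun o : option 'I_(S k) =>
    if o is Some l then g_sigma_algebra_preimage (@xi k i l)
    else sigma_samples xi [set j | (j < k)%N]).
Hypothesis unbiased : unbiased_oracle X_ xi0 ft x0 gamma xi T.
Hypothesis variance : bounded_variance_oracle X_ xi0 ft x0 gamma xi T sigma.
Context {P : profile -> R} {L Pmax Pmin : R}.
Hypothesis potential : smooth_potential X_ xi0 ft P L Pmax Pmin.
Hypotheses (gammaL : forall k, gamma k <= L^-1) (L0 : 0 < L).

Notation EGt k := (\int[Pr]_w dot (Gtk k w) (Gtk k w)).
Notation EG k := (\int[Pr]_w dot (Gk k w) (Gk k w)).

Lemma sum_Gt_le :
  \sum_(k < T) (gamma k.+1 - L / 2 * gamma k.+1 ^+ 2) * EGt k.+1 <=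
    Pmax - Pmin + \sum_(k < T) gamma k.+1 * (sigma ^+ 2 * N%:R / (S k.+1)%:R).
Proof.
pose c k := gamma k - L / 2 * gamma k ^+ 2.
have IGt (k : 'I_T) : L1 (fun w => dot (Gtk k.+1 w) (Gtk k.+1 w)).
  exact: (Gt_sqr_L1 (S_gt0 _) (unbiased (ltn_ord k)) (variance (ltn_ord k))
    potential).
have Ie (k : 'I_T) : L1 (fun w => dot (batch_noise k.+1 w) (batch_noise k.+1 w)).
  exact: (batch_noise_L1 (S_gt0 _) (unbiased (ltn_ord k)) (variance (ltn_ord k))).
have IeG (k : 'I_T) : L1 (fun w => dot (batch_noise k.+1 w) (Gk k.+1 w)).
  exact: (batch_noise_G_L1 (S_gt0 _) (unbiased (ltn_ord k)) potential).
pose f w := \sum_(k < T) c k.+1 * dot (Gtk k.+1 w) (Gtk k.+1 w).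
pose g w := \sum_(k < T) gamma k.+1 * dot (batch_noise k.+1 w) (batch_noise k.+1 w).
pose h w := \sum_(k < T) gamma k.+1 * dot (batch_noise k.+1 w) (Gk k.+1 w).
have If : L1 f by apply: L1_sum => k; exact: L1Z.
have Ig : L1 g by apply: L1_sum => k; exact: L1Z.
have Ih : L1 h by apply: L1_sum => k; exact: L1Z.
have fgh w : f w <= Pmax - Pmin + h w + g w.
  (* Iteration 0 is not an output candidate, so the sum covers the steps from [x^1] to [x^(T+1)]. *)
  have tele (u : nat -> R) : \sum_(k < T) (u k.+1 - u k.+2) = u 1 - u T.+1.
    elim: (T) => [|n IH]; first by rewrite big_ord0 subrr.
    by rewrite big_ord_recr/= IH addrA subrK.
  have /andP[_ b1] := potential_bounds potential (iterate_feasible 1 w).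
  have /andP[b2 _] := potential_bounds potential (iterate_feasible T.+1 w).
  apply: (@le_trans _ _ (P (xk 1 w) - P (xk T.+1 w) + h w + g w)).
    rewrite -(tele (fun k => P (xk k w))) /h /g -2!big_split.
    by apply: ler_sum => k _; exact: (iterate_potential_step k.+1 potential w).
  by rewrite !lerD2r lerB.
have <- : \int[Pr]_w f w = \sum_(k < T) c k.+1 * EGt k.+1.
  rewrite Rintegral_sum => [|k]; last exact: L1Z.
  by apply: eq_bigr => k _; rewrite RintegralZl.
have Irhs := L1D (L1D (L1_cst Pr (Pmax - Pmin)) Ih) Ig.
apply: (le_trans (le_Rintegral measurableT If Irhs _)).
  by move=> w _; exact: fgh.
rewrite RintegralD//; last exact: L1D (L1_cst _ _) Ih.
rewrite RintegralD//; last exact: L1_cst.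
rewrite Rintegral_cst// [X in fine X](@probability_setT _ _ _ Pr) mulr1.
have -> : \int[Pr]_w h w = 0.
  rewrite Rintegral_sum => [|k]; last exact: L1Z.
  rewrite big1// => k _; rewrite RintegralZl//.
  by rewrite (batch_noise_G_eq0 (S_gt0 _) (unbiased (ltn_ord k)) potential)// mulr0.
rewrite addr0 lerD2l Rintegral_sum => [|k]; last exact: L1Z.
apply: ler_sum => k _; rewrite RintegralZl// ler_pM2l//.
exact: (batch_noise_variance (S_gt0 _) (@fresh _) (unbiased (ltn_ord k))
    (variance (ltn_ord k))).
Qed.

Context (pR : nat -> R) (Rv : {RV Pr >-> nat}).
Hypothesis output_pmf : forall k, Pr (Rv @^-1` [set k]) = (pR k)%:E.
Hypothesis output_support : forall k, ~~ (1 <= k <= T)%N -> pR k = 0.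
Hypothesis output_indep :
    mutually_independent Pr (fun b : bool =>
      if b then g_sigma_algebra_preimage Rv else sigma_samples xi setT).

Lemma expectation_output (H : nat -> Om -> R) :
  (forall k w, 0 <= H k w) ->
  (forall k, (1 <= k <= T)%N -> measurable_fun setT
    (H k : g_sigma_algebraType (sample_events setT) -> R)) ->
  (forall k, (1 <= k <= T)%N -> L1 (H k)) ->
  ('E_Pr[fun w => H (Rv w) w] <=
     (\sum_(k < T) pR k.+1 * \int[Pr]_w H k.+1 w)%:E)%E.
Proof.
move=> H0 mH IH.
apply: (@expectation_random_index _ _ _ _ _ _ _ output_pmf output_support
  (sigma_samples xi setT)) => //.
- by move=> A; apply: g_sigma_algebra_measurable; exact: sample_events_measurable.
- move=> A B SA SB.
  exact: (@measurableI _ (g_sigma_algebraType (sample_events setT))).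
- exact: (@measurableT _ (g_sigma_algebraType (sample_events setT))).
- move=> A k SA.
  apply: (mutually_independent2 output_indep (a := false) (b := true)) => //.
  by exists [set k] => //; rewrite setTI.
- move=> k /mH; apply: g_sigma_measurable_funS => A SA.
  by apply: sub_sigma_algebra; exact: sub_sigma_algebra.
Qed.

(** The random-index bound for the constant 1. It makes the normalizing sum of part (i) positive and
    forces [T >= 1] in part (ii). *)
Lemma sum_pmf_ge1 : 1 <= \sum_(k < T) pR k.+1.
Proof.
have := @expectation_output (fun _ _ => 1) _ _ _.
rewrite expectation_cst lee_fin => H; apply: le_trans (H _ _ _) _ => //.
- by move=> k _; exact: L1_cst.
- apply: ler_sum => k _.
  by rewrite Rintegral_cst// [X in fine X](@probability_setT _ _ _ Pr) !mulr1.
Qed.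

Lemma expectation_Gt :
  ('E_Pr[fun w => (enorm (Gtk (Rv w) w) ^+ 2)%R] <=
     (\sum_(k < T) pR k.+1 * EGt k.+1)%:E)%E.
Proof.
have -> : (fun w => enorm (Gtk (Rv w) w) ^+ 2) =
    (fun w => dot (Gtk (Rv w) w) (Gtk (Rv w) w)).
  by apply/funext => w; rewrite enorm_sqr.
apply: (@expectation_output (fun k w => dot (Gtk k w) (Gtk k w)))
  => [k w|k _|k /andP[_ kT]].
- exact: dot_ge0.
- exact: Gt_sqr_measurable.
- exact: (Gt_sqr_L1 (S_gt0 _) (unbiased kT) (variance kT) potential).
Qed.

Lemma expectation_G :
  ('E_Pr[fun w => (enorm (Gk (Rv w) w) ^+ 2)%R] <=
     (\sum_(k < T) pR k.+1
       * (2 * EGt k.+1 + 2 * (sigma ^+ 2 * N%:R / (S k.+1)%:R)))%:E)%E.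
Proof.
have -> : (fun w => enorm (Gk (Rv w) w) ^+ 2) =
    (fun w => dot (Gk (Rv w) w) (Gk (Rv w) w)).
  by apply/funext => w; rewrite enorm_sqr.
have pR0 k : 0 <= pR k by rewrite -lee_fin -output_pmf.
apply: (@le_trans _ _ (\sum_(k < T) pR k.+1 * EG k.+1)%:E); last first.
  rewrite lee_fin; apply: ler_sum => k _; rewrite ler_wpM2l//.
  exact: (G_sqr_expectation_le (S_gt0 _) (@fresh _) (unbiased (ltn_ord k))
    (variance (ltn_ord k)) potential).
apply: (@expectation_output (fun k w => dot (Gk k w) (Gk k w)))
  => [k w|k /andP[_ kT]|k /andP[_ kT]].
- exact: dot_ge0.
(* G depends on the samples only through the iterate, so measurability for [sigma_iterate] is
   transferred to the sigma-algebra of all samples. *)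
- apply: g_sigma_measurable_funS (G_sqr_measurable_sigma (S_gt0 _) (unbiased kT)).
  move=> A [B mB <-].
  exact: (@iterate_measurable_samples k setT).
- exact: (G_sqr_L1 (S_gt0 _) (unbiased kT) potential).
Qed.

Let Pmax_ge : Pmin <= Pmax.
Proof. by have /andP[b1 b2] := potential_bounds potential Xx0; exact: le_trans b1 b2. Qed.

Lemma LD_sqr : L * Num.sqrt ((Pmax - Pmin) / L) ^+ 2 = Pmax - Pmin.
Proof.
rewrite sqr_sqrtr; first by rewrite mulrC divfK// gt_eqF.
by rewrite divr_ge0 ?subr_ge0// ltW.
Qed.

Let EGt_ge0 k : 0 <= EGt k.
Proof. by apply: Rintegral_ge0 => w _; exact: dot_ge0. Qed.

(** Compares the numerators of the output probabilities with the coefficients that the descent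
    inequality provides. *)
Let gamma_step k : 0 <= gamma k - L * gamma k ^+ 2 <= gamma k - L / 2 * gamma k ^+ 2.
Proof.
have Lg : L * gamma k <= 1 by rewrite mulrC -ler_pdivlMr// div1r.
have H1 : L * gamma k ^+ 2 <= gamma k.
  by rewrite expr2 mulrA -[leRHS]mul1r ler_wpM2r// ltW.
have H2 : 0 <= L * gamma k ^+ 2 by rewrite mulr_ge0 ?sqr_ge0// ltW.
move: H1 H2; move: (gamma k) (gamma k ^+ 2) => a b H1 H2.
by rewrite subr_ge0 H1/=; lra.
Qed.

Lemma expectation_Gt_le :
  (forall k, (1 <= k <= T)%N ->
     pR k = (gamma k - L * gamma k ^+ 2)
            / \sum_(1 <= j < T.+1) (gamma j - L * gamma j ^+ 2)) ->
  ('E_Pr[fun w => (enorm (Gtk (Rv w) w) ^+ 2)%R] <=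
    ((L * Num.sqrt ((Pmax - Pmin) / L) ^+ 2 + sigma ^+ 2 * N%:R
        * \sum_(1 <= k < T.+1) (gamma k / (S k)%:R))
     / \sum_(1 <= k < T.+1) (gamma k - L * gamma k ^+ 2))%:E)%E.
Proof.
rewrite LD_sqr !big_add1 !big_mkord /=.
pose a k := gamma k - L * gamma k ^+ 2; set den := \sum_(k < T) _ => pE.
have pE' (k : 'I_T) : pR k.+1 = a k.+1 / den by rewrite pE//= ltn_ord.
(* If the denominator were 0, division by zero would make every output probability 0, against a
   total mass of at least 1. *)
have den0 : 0 < den.
  rewrite lt_neqAle eq_sym; apply/andP; split; last first.
    by apply: sumr_ge0 => k _; have /andP[] := gamma_step k.+1.
  apply/eqP => den0; have := sum_pmf_ge1.
  rewrite big1 ?ler10// => k _; by rewrite pE' den0 invr0 mulr0.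
apply: le_trans expectation_Gt _; rewrite lee_fin ler_pdivlMr// mulr_suml.
apply: (@le_trans _ _ (\sum_(k < T) (gamma k.+1 - L / 2 * gamma k.+1 ^+ 2) * EGt k.+1)).
  apply: ler_sum => k _; rewrite pE' mulrAC divfK ?gt_eqF//.
  by rewrite ler_wpM2r//; have /andP[] := gamma_step k.+1.
apply: le_trans sum_Gt_le _; rewrite lerD2l mulr_sumr.
apply: ler_sum => k _; rewrite mulrCA mulrA mulrC.
exact: lexx.
Qed.

Lemma expectation_G_le (s : nat) :
  (forall k, (1 <= k <= T)%N -> gamma k = (2 * L)^-1) ->
  (forall k, (1 <= k <= T)%N -> pR k = T%:R^-1) ->
  (forall k, S k = s) ->
  (0 < T)%N /\
  ('E_Pr[fun w => (enorm (Gk (Rv w) w) ^+ 2)%R] <=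
    (8 * L * (Pmax - Pmin) / T%:R + 6 * (sigma ^+ 2 * N%:R / s%:R))%:E)%E.
Proof.
move=> gE pE SE.
have T0 : (0 < T)%N.
  by rewrite lt0n; apply/eqP => T0; have := sum_pmf_ge1; rewrite T0 big_ord0 ler10.
split=> //; apply: le_trans expectation_G _; rewrite lee_fin.
have TR : (0 : R) < T%:R by rewrite ltr0n.
set v := sigma ^+ 2 * N%:R / s%:R.
have v0 : 0 <= v.
  by apply: divr_ge0; [apply: mulr_ge0; [exact: sqr_ge0|exact: ler0n]|exact: ler0n].
have -> : \sum_(k < T) pR k.+1
      * (2 * EGt k.+1 + 2 * (sigma ^+ 2 * N%:R / (S k.+1)%:R)) =
    T%:R^-1 * (2 * \sum_(k < T) EGt k.+1) + 2 * v.
  transitivity (\sum_(k < T) (T%:R^-1 * (2 * EGt k.+1) + T%:R^-1 * (2 * v))).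
    by apply: eq_bigr => k _; rewrite SE pE ?mulrDr//= ltn_ord.
  rewrite big_split/=; congr (_ + _); first by rewrite -!mulr_sumr.
  by rewrite sumr_const card_ord -[LHS]mulr_natl mulVKf// gt_eqF.
have := sum_Gt_le.
(* [3 / (8 L)] is the value of [g - L g^2 / 2] at [g = 1/(2L)]. *)
have -> : \sum_(k < T) (gamma k.+1 - L / 2 * gamma k.+1 ^+ 2) * EGt k.+1 =
    3 / (8 * L) * \sum_(k < T) EGt k.+1.
  rewrite mulr_sumr; apply: eq_bigr => k _; congr (_ * _).
  rewrite gE/= ?ltn_ord//; field.
  by rewrite gt_eqF.
have -> : \sum_(k < T) gamma k.+1 * (sigma ^+ 2 * N%:R / (S k.+1)%:R) =
    T%:R * ((2 * L)^-1 * v).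
  transitivity (\sum_(k < T) (2 * L)^-1 * v).
    by apply: eq_bigr => k _; rewrite SE gE//= ltn_ord.
  by rewrite sumr_const card_ord -[LHS]mulr_natl.
set E := \sum_(k < T) _ => H.
(* The factors 8/3 and 4/3 that come out are relaxed to 4 and 2; doubling, dividing by [T] and
   adding [2 v] then yields the constants 8 and 6. *)
have {}H : E <= 4 * L * (Pmax - Pmin) + 2 * (T%:R * v).
  have E0 : 0 <= E by exact: sumr_ge0.
  have : 8 * L * (3 / (8 * L) * E) <= 8 * L * (Pmax - Pmin + T%:R * ((2 * L)^-1 * v)).
    by rewrite ler_pM2l// mulr_gt0.
  have -> : 8 * L * (3 / (8 * L) * E) = 3 * E by field; rewrite gt_eqF.
  have -> : 8 * L * (Pmax - Pmin + T%:R * ((2 * L)^-1 * v)) =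
      8 * (L * (Pmax - Pmin)) + 4 * (T%:R * v) by field; rewrite gt_eqF.
  have : 0 <= L * (Pmax - Pmin) by rewrite mulr_ge0 ?subr_ge0// ltW.
  have : 0 <= T%:R * v by rewrite mulr_ge0 ?ler0n.
  rewrite -mulrA; move: (L * _) (_ * v) E0 => a b E0; lra.
have -> : 8 * L * (Pmax - Pmin) / T%:R + 6 * v =
    2 / T%:R * (4 * L * (Pmax - Pmin) + 2 * (T%:R * v)) + 2 * v.
  by field; rewrite gt_eqF.
have -> : T%:R^-1 * (2 * E) = 2 / T%:R * E by rewrite mulrA [_ * 2]mulrC.
by rewrite lerD2r ler_pM2l// divr_gt0.
Qed.

End Run.
End Scheme.

(** Inserting [T >= M / (2 n s)] bounds the left side by [16 L^2 D^2 n s / M + 6 sigma^2 n / s]. The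
    unrounded batch size [q] makes both terms equal to [4 t L D n sigma / r]. Rounding up uses
    [s <= q + 1] in the increasing term, at the price of [16 L^2 D^2 n / M], and [q <= s] in the
    decreasing one. The variables [t] and [r] stand for the roots of 6 and [M], so that only
    rational identities remain. *)
Lemma batch_size_tradeoff (R : realType) (L D n sigma M s T t r : R) :
  0 < L -> 0 < D -> 0 < sigma -> 0 < n -> 0 < r -> 0 < t -> 0 < T ->
  t ^+ 2 = 6 -> r ^+ 2 = M ->
  sigma * (t * r) / (4 * L * D) <= s <= sigma * (t * r) / (4 * L * D) + 1 ->
  M <= 2 * T * n * s ->
  8 * L * (L * D ^+ 2) / T + 6 * (sigma ^+ 2 * n / s) <=
    16 * L ^+ 2 * D ^+ 2 * n / M + 8 * t * L * D * n * sigma / r.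
Proof.
move=> L0 D0 sigma0 n0 r0 t0 T0 t6 rM; set q := _ / (4 * L * D) => /andP[qs sq] MT.
have q0 : 0 < q by rewrite divr_gt0 ?mulr_gt0.
have s0 : 0 < s by exact: lt_le_trans qs.
have M0 : 0 < M by rewrite -rM exprn_gt0.
have H1 : 8 * L * (L * D ^+ 2) / T <= 16 * L ^+ 2 * D ^+ 2 * n * (q + 1) / M.
  apply: (@le_trans _ _ (16 * L ^+ 2 * D ^+ 2 * n * s / M)); last first.
    rewrite ler_pM2r ?invr_gt0// ler_pM2l//.
    by rewrite !mulr_gt0// exprn_gt0.
  rewrite ler_pdivlMr// mulrAC ler_pdivrMr//.
  have -> : 16 * L ^+ 2 * D ^+ 2 * n * s * T =
      8 * L * (L * D ^+ 2) * (2 * T * n * s) by ring.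
  by rewrite ler_pM2l// !mulr_gt0// exprn_gt0.
have H2 : 6 * (sigma ^+ 2 * n / s) <= 6 * (sigma ^+ 2 * n / q).
  rewrite ler_pM2l// ler_pM2l ?mulr_gt0 ?exprn_gt0//.
  by rewrite lef_pV2 ?posrE.
apply: (le_trans (lerD H1 H2)); rewrite le_eqVlt; apply/orP; left; apply/eqP.
rewrite /q -rM -[6]t6.
by field; rewrite !gt_eqF.
Qed.

Theorem theorem3p1 (R : realType) (N : nat) (n_ : 'I_N -> nat) (m : nat)
    (X_ : forall i, set 'rV[R]_(n_ i))
    (d0 : measure_display) (Om0 : measurableType d0) (Q : probability Om0 R)
    (xi0 : {RV Q >-> Rvec R m})
    (ft : 'I_N -> 'rV[R]_(\sum_i n_ i) -> 'rV[R]_m -> R)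
    (P : 'rV[R]_(\sum_i n_ i) -> R) (L Pmax Pmin sigma : R) :
  (0 < N)%N -> 0 < L -> 0 < sigma ->
  smooth_stochastic_game X_ xi0 ft ->
  smooth_potential X_ xi0 ft P L Pmax Pmin ->
  let D := Num.sqrt ((Pmax - Pmin) / L) in
  (forall (d : measure_display) (Om : measurableType d) (Pr : probability Om R)
      (x0 : 'rV[R]_(\sum_i n_ i)) (T : nat) (gamma : nat -> R) (S : nat -> nat)
      (xi : forall k : nat, 'I_N -> 'I_(S k) -> {RV Pr >-> Rvec R m})
      (pR : nat -> R) (Rv : {RV Pr >-> nat}),
    rsg_scheme X_ xi0 x0 xi T pR Rv ->
    unbiased_oracle X_ xi0 ft x0 gamma xi T ->
    bounded_variance_oracle X_ xi0 ft x0 gamma xi T sigma ->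
    (forall k, 0 < gamma k <= L^-1) -> (exists k, gamma k < L^-1) ->
    (forall k, (1 <= k <= T)%N ->
       pR k = (gamma k - L * gamma k ^+ 2)
              / \sum_(1 <= j < T.+1) (gamma j - L * gamma j ^+ 2)) ->
    (1 <= T)%N ->
    ('E_Pr[fun w => (enorm (Gt X_ ft x0 gamma xi (Rv w) w) ^+ 2)%R] <=
      ((L * D ^+ 2 + sigma ^+ 2 * N%:R
          * \sum_(1 <= k < T.+1) (gamma k / (S k)%:R))
       / \sum_(1 <= k < T.+1) (gamma k - L * gamma k ^+ 2))%:E)%E)
  /\
  (exists M0 : nat, forall M : nat, (M0 <= M)%N ->
    forall (d : measure_display) (Om : measurableType d) (Pr : probability Om R)
      (x0 : 'rV[R]_(\sum_i n_ i)) (T : nat) (gamma : nat -> R) (S : nat -> nat)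
      (xi : forall k : nat, 'I_N -> 'I_(S k) -> {RV Pr >-> Rvec R m})
      (pR : nat -> R) (Rv : {RV Pr >-> nat}) (Sbar : nat),
    rsg_scheme X_ xi0 x0 xi T pR Rv ->
    unbiased_oracle X_ xi0 ft x0 gamma xi T ->
    bounded_variance_oracle X_ xi0 ft x0 gamma xi T sigma ->
    (forall k, 0 < gamma k <= L^-1) -> (exists k, gamma k < L^-1) ->
    (forall k, (1 <= k <= T)%N -> gamma k = (2 * L)^-1) ->
    (forall k, (1 <= k <= T)%N -> pR k = T%:R^-1) ->
    Sbar%:Z = Num.ceil (sigma * Num.sqrt (6 * M%:R) / (4 * L * D)) ->
    (forall k, S k = Sbar) ->
    (* the budget of M oracle calls allows T iterations, and no more *)
    (\sum_(k < T) N * S k <= M < \sum_(k < T.+1) N * S k)%N ->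
    (T <= M %/ (Sbar * N))%N /\
    ('E_Pr[fun w => (enorm (G X_ xi0 ft x0 gamma xi (Rv w) w) ^+ 2)%R] <=
      (16 * L ^+ 2 * D ^+ 2 * N%:R / M%:R
       + 8 * Num.sqrt 6 * L * D * N%:R * sigma / Num.sqrt M%:R)%:E)%E).
Proof.
move=> N0 L0 sigma0 game potential D; split.
  move=> d Om Pr x0 T gamma S xi pR Rv.
  move=> [Xx0 S_gt0 _ fresh pmf supp indep] unbiased variance g0L _ pE _.
  have g0 k : 0 < gamma k by have /andP[] := g0L k.
  have gL k : gamma k <= L^-1 by have /andP[] := g0L k.
  exact: (expectation_Gt_le game Xx0 g0 S_gt0 fresh unbiased variance potential
    gL L0 pmf supp indep pE).
(* Large enough just means positive: the estimate divides by [M]. *)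
exists 1%N => M M_gt0 d Om Pr x0 T gamma S xi pR Rv s.
move=> [Xx0 S_gt0 _ fresh pmf supp indep] unbiased variance g0L _ gE pE sE SE.
have g0 k : 0 < gamma k by have /andP[] := g0L k.
have gL k : gamma k <= L^-1 by have /andP[] := g0L k.
have s_gt0 : (0 < s)%N by rewrite -(SE 0%N).
have sum_calls n : (\sum_(k < n) N * S k = n * (s * N))%N.
  transitivity (\sum_(k < n) s * N)%N; last by rewrite sum_nat_const card_ord.
  by apply: eq_bigr => k _; rewrite SE mulnC.
rewrite !sum_calls => /andP[TM MT]; split.
  by rewrite leq_divRL// muln_gt0 s_gt0.
have [T_gt0 EG] := expectation_G_le game Xx0 g0 S_gt0 fresh unbiased variance potential
    gL L0 pmf supp indep gE pE SE.
apply: le_trans EG _; rewrite lee_fin.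
rewrite -(LD_sqr Xx0 potential L0) -/D.
have MR : (0 : R) < M%:R by rewrite ltr0n.
(* For [D = 0] the quotient defining the batch size is 0 by the convention for division by zero, and
   so is its ceiling; but batches are nonempty. *)
have D0 : 0 < D.
  rewrite lt_neqAle sqrtr_ge0 andbT eq_sym; apply/eqP => D0.
  by move: sE; rewrite D0 mulr0 invr0 mulr0 ceil0 => -[s0]; move: s_gt0; rewrite s0.
have sqrtE : Num.sqrt (6 * M%:R) = Num.sqrt 6 * Num.sqrt M%:R :> R.
  by rewrite sqrtrM.
apply: batch_size_tradeoff => //; rewrite ?sqrtr_gt0 ?ltr0n ?sqr_sqrtr//.
- rewrite -sqrtE; have := ceil_itv (sigma * Num.sqrt (6 * M%:R) / (4 * L * D)).
  rewrite -sE intrB => /andP[/ltW c1 ->] /=.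
  by rewrite -lerBlDr.
(* Iteration [T + 1] would exceed the budget, and [T + 1 <= 2 T] because [T >= 1]. *)
- rewrite -!natrM ler_nat (leq_trans (ltnW MT))//.
  rewrite -mulnA [(N * s)%N]mulnC leq_mul2r mul2n -addnn -addn1.
  by rewrite leq_add2l T_gt0 orbT.
Qed.
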